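(* Let $k<d$. There is a function $\delta(\cdot,k):(0,\infty)\to(0,\infty)$ with $\lim_{\epsilon\to0}\delta(\epsilon,k)=0$ such that the following holds. Let $\epsilon>0$ and let $c=(M_1,\dots,M_k)$ be a tuple of self-adjoint $d\times d$ matrices with $\|M_i\|\le1$ for all $i\in[k]$ and $\|M_iM_j-M_jM_i\|_{\mathrm{tr}}\le\epsilon$ for all $i,j\in[k]$. Then there exists a tuple $\bar c=(\bar M_1,\dots,\bar M_k)$ of self-adjoint $d\times d$ matrices with $\bar M_i\bar M_j=\bar M_j\bar M_i$ for all $i,j\in[k]$ and $$\mathrm{dist}(c,\bar c)\le\delta(\epsilon,k).$$ Assume furthermore that $\bar c\in\mathcal{C}$ and that the associated assignment LP of $\bar c$ has a unique optimal solution. Then there is a full-dimensional neighborhood $\bar{\mathcal{C}}$ of $\bar c$ in $\mathcal{C}$, such that (SDP-P) has the rank-one property for every coefficient tuple in $\bar{\mathcal{C}}$, and if $\epsilon>0$ is such that $\mathrm{dist}(c,\bar c)\le\delta(\epsilon,k)$ implies $c\in\bar{\mathcal{C}}$, then (SDP-P) with coefficients $c$ has the rank-one property.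
   Context: $\|A\|$ is the spectral norm; for $A\in\mathbb{R}^{d\times d}$, $\|A\|_{\mathrm{tr}}:=\frac1{\sqrt d}\|A\|_{\mathrm F}$ is the normalized Frobenius norm. $[k]=\{1,\dots,k\}$. For $c=(M_i)_{i}$ and $\bar c=(\bar M_i)_i$, $\mathrm{dist}(c,\bar c):=\max_{i\in[k]}\|M_i-\bar M_i\|_{\mathrm{tr}}$. For a fixed $\mu>0$, $\mathcal{C}=\{(M_1,\dots,M_k):M_i\text{ symmetric } d\times d,\ 0\preceq M_i\preceq\mu I\ \forall i\}$. (SDP-P) with coefficients $(M_1,\dots,M_k)$ is $$\max_{X_1,\dots,X_k}\ \mathrm{tr}\Big(\sum_{i=1}^kM_iX_i\Big)\quad\text{s.t. }\ \sum_{i=1}^kX_i\preceq I,\quad \mathrm{tr}(X_i)=1,\quad X_i\succeq0,\quad i=1,\dots,k,$$ over symmetric $d\times d$ matrices. A feasible solution has the rank-one property if all $X_i$ have rank one; (SDP-P) has the rank-one property if its optimal solutions do. For commuting symmetric $\bar M_1,\dots,\bar M_k$, pick an orthogonal $Q$ with $Q'\bar M_iQ=\mathrm{diag}(\bar m_i)$ for all $i$; the associated assignment LP is $$\max\Big\{\sum_{i=1}^k\bar m_i'x_i:\ x_i\in\mathbb{R}^d,\ x_i\ge0,\ \mathbf 1'x_i=1\ (i\in[k]),\ \sum_{i=1}^kx_i\le\mathbf 1\Big\}.$$ A full-dimensional neighborhood of $\bar c$ in $\mathcal{C}$ is a subset of $\mathcal{C}$ containing $\bar c$, relatively open in $\mathcal{C}$,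 with nonempty interior in the space of $k$-tuples of symmetric matrices. *)

(* Defs.v *)
From mathcomp Require Import all_boot all_order all_algebra.
From mathcomp Require Import all_classical all_reals all_analysis.

Set Implicit Arguments.
Unset Strict Implicit.
Unset Printing Implicit Defensive.

Import Order.TTheory GRing.Theory Num.Theory.
Import numFieldNormedType.Exports.

Local Open Scope classical_set_scope.
Local Open Scope ring_scope.

Section Norms.
Context {R : realType}.

Definition frobnorm m n (A : 'M[R]_(m, n)) : R :=
  Num.sqrt (\sum_i \sum_j A i j ^+ 2).

(* The Frobenius norm of a column vector is its Euclidean norm. *)
Definition specnorm d (A : 'M[R]_d) : R :=
  sup [set frobnorm (A *m x) | x in [set x : 'cV[R]_d | frobnorm x <= 1]].

Definition trnorm d (A : 'M[R]_d) : R := (Num.sqrt d%:R)^-1 * frobnorm A.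

Definition dist k d (c c' : 'I_k -> 'M[R]_d) : R :=
  \big[Num.max/0]_(i < k) trnorm (c i - c' i).

End Norms.

Section Semidefinite.
Context {R : realType}.

Definition symmetric_mx d (A : 'M[R]_d) : Prop := A^T = A.

Definition psd d (A : 'M[R]_d) : Prop :=
  symmetric_mx A /\ forall x : 'cV[R]_d, 0 <= (x^T *m A *m x) 0 0.

Definition loewner_le d (A B : 'M[R]_d) : Prop := psd (B - A).

Definition symtuples {k d} : set ('I_k -> 'M[R]_d) :=
  [set c | forall i, symmetric_mx (c i)].

Definition coeffs (mu : R) {k d} : set ('I_k -> 'M[R]_d) :=
  [set c | forall i, [/\ symmetric_mx (c i), loewner_le 0 (c i)
                       & loewner_le (c i) mu%:M]].

Definition commuting k d (c : 'I_k -> 'M[R]_d) : Prop :=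
  forall i j, comm_mx (c i) (c j).

Definition sdp_feasible k d (X : 'I_k -> 'M[R]_d) : Prop :=
  [/\ loewner_le (\sum_i X i) 1%:M, forall i, \tr (X i) = 1
    & forall i, psd (X i)].

Definition sdp_objective k d (c X : 'I_k -> 'M[R]_d) : R :=
  \tr (\sum_i c i *m X i).

Definition sdp_optimal k d (c X : 'I_k -> 'M[R]_d) : Prop :=
  sdp_feasible X /\
  forall Y, sdp_feasible Y -> sdp_objective c Y <= sdp_objective c X.

Definition rank_one k d (X : 'I_k -> 'M[R]_d) : Prop :=
  forall i, \rank (X i) = 1%N.

Definition sdp_rank_one k d (c : 'I_k -> 'M[R]_d) : Prop :=
  forall X, sdp_optimal c X -> rank_one X.

End Semidefinite.

Section AssignmentLP.
Context {R : realType}.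

Definition lp_feasible k d (x : 'I_k -> 'cV[R]_d) : Prop :=
  [/\ forall i j, 0 <= x i j 0, forall i, \sum_j x i j 0 = 1
    & forall j, \sum_i x i j 0 <= 1].

Definition lp_objective k d (m x : 'I_k -> 'cV[R]_d) : R :=
  \sum_i ((m i)^T *m x i) 0 0.

Definition lp_optimal k d (m x : 'I_k -> 'cV[R]_d) : Prop :=
  lp_feasible x /\
  forall y, lp_feasible y -> lp_objective m y <= lp_objective m x.

Definition lp_unique_optimum k d (m : 'I_k -> 'cV[R]_d) : Prop :=
  exists! x, lp_optimal m x.

Definition diagonalizes k d (Q : 'M[R]_d) (c : 'I_k -> 'M[R]_d)
    (m : 'I_k -> 'cV[R]_d) : Prop :=
  Q^T *m Q = 1%:M /\ forall i, Q^T *m c i *m Q = diag_mx (m i)^T.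

End AssignmentLP.

Section Neighborhood.
Context {R : realType}.

(* [{ptws _ -> _}] carries the product topology on all k-tuples of d x d
   matrices; openness in the coefficient set, and the interior in the
   space of symmetric tuples, are taken for the induced topologies. *)
Definition full_dim_nbhd (mu : R) k d (c : 'I_k -> 'M[R]_d)
    (N : set ('I_k -> 'M[R]_d)) : Prop :=
  [/\ N `<=` coeffs mu,
      N c,
      exists2 U : set {ptws 'I_k -> 'M[R]_d}, open U & N = coeffs mu `&` U
    & exists U : set {ptws 'I_k -> 'M[R]_d},
        [/\ open U, symtuples `&` U !=set0 & symtuples `&` U `<=` N]].

End Neighborhood.

(* Main.v *)
(* Almost commuting matrices.  Make the matrices commute one at a time.  In an
   eigenbasis of c_r, cut the spectrum into cells of length h, replace c_r by
   a constant on each cell and pinch the other matrices to the diagonal blocks.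
   The entries of [c_r, c_j] are (l_a - l_b) c_j(a,b), and a and b are separated
   by a randomly shifted grid with probability at most |l_a - l_b| / h; so on
   average the pinching discards little, uniformly in d.  Pinching preserves
   contractions and all commutation relations obtained before.

   Rank one near a commuting tuple.  Diagonalise the commuting tuple.  The
   assignment LP has an optimal vertex given by an injection s; uniqueness
   leaves a gap, which an equilibrium for slightly increased weights off s turns
   into a strictly complementary dual (lam, y).  For a nearby tuple c let v
   maximise sum_i v_i' c_i v_i over orthonormal k-frames.  The gap forces v_i to
   be close to +-e_{s i}, and the first order conditions say that
   L_ij = v_i' c_i v_j is symmetric and c_i v_i lies in the span of v.  Hence
   Y = V (L - diag lam) V' satisfies (Y + lam_i - c_i) v_i = 0 exactly, while
   strict complementarity at the diagonal tuple makes Y psd and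
   Y + lam_i - c_i positive on the complement of v_i: complementary slackness
   gives X_i = v_i v_i'. *)
Require Import Defs.
From mathcomp Require Import all_boot all_order all_algebra.
From mathcomp Require Import all_classical all_reals all_analysis.
From mathcomp Require Import ring lra.

Set Implicit Arguments.
Unset Strict Implicit.
Unset Printing Implicit Defensive.

Import Order.TTheory GRing.Theory Num.Theory.
Import numFieldNormedType.Exports.

Local Open Scope classical_set_scope.
Local Open Scope ring_scope.

(** * Squared Frobenius norm, inner product and contractions *)

Section Basics.
Context {R : realType}.

(** All estimates are made on the square of the Frobenius norm; roots appear only when the norms of
    the statement are translated. *)
Definition frobsq m n (A : 'M[R]_(m, n)) : R := \sum_i \sum_j A i j ^+ 2.

Lemma frobsq_ge0 m n (A : 'M[R]_(m, n)) : 0 <= frobsq A.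
Proof. by apply: sumr_ge0 => i _; apply: sumr_ge0 => j _; exact: sqr_ge0. Qed.

Lemma frobsq0 m n : frobsq (0 : 'M[R]_(m, n)) = 0.
Proof.
rewrite /frobsq big1 // => i _; rewrite big1 // => j _.
by rewrite mxE expr0n.
Qed.

Lemma frobsq_eq0 m n (A : 'M[R]_(m, n)) : frobsq A = 0 -> A = 0.
Proof.
move/eqP; rewrite psumr_eq0; last first.
  by move=> i _; apply: sumr_ge0 => j _; exact: sqr_ge0.
move/allP => A0; apply/matrixP => i j; rewrite mxE.
have := A0 i (mem_index_enum i); rewrite /= psumr_eq0; last first.
  by move=> l _; exact: sqr_ge0.
by move/allP/(_ j (mem_index_enum j)); rewrite /= sqrf_eq0 => /eqP.
Qed.

Lemma frobsqE m n (A : 'M[R]_(m, n)) : frobsq A = \tr (A^T *m A).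
Proof.
rewrite /frobsq exchange_big; apply: eq_bigr => j _; rewrite mxE.
by apply: eq_bigr => i _; rewrite mxE expr2.
Qed.

Lemma frobsqT m n (A : 'M[R]_(m, n)) : frobsq A^T = frobsq A.
Proof.
rewrite /frobsq exchange_big; apply: eq_bigr => j _.
by apply: eq_bigr => i _; rewrite mxE.
Qed.

Lemma frobsqN m n (A : 'M[R]_(m, n)) : frobsq (- A) = frobsq A.
Proof.
by apply: eq_bigr => i _; apply: eq_bigr => j _; rewrite mxE sqrrN.
Qed.

Lemma frobsqZ m n a (A : 'M[R]_(m, n)) : frobsq (a *: A) = a ^+ 2 * frobsq A.
Proof.
rewrite /frobsq big_distrr; apply: eq_bigr => i _; rewrite big_distrr.
by apply: eq_bigr => j _; rewrite mxE exprMn.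
Qed.

(** Replaces the triangle inequality: the factor 2 is the price for staying linear in the
    squares. *)
Lemma frobsqD m n (A B : 'M[R]_(m, n)) :
  frobsq (A + B) <= 2 * (frobsq A + frobsq B).
Proof.
rewrite /frobsq -big_split big_distrr; apply: ler_sum => i _.
rewrite -big_split big_distrr; apply: ler_sum => j _.
by rewrite !mxE /=; have := sqr_ge0 (A i j - B i j); nra.
Qed.

Lemma frobsqB m n (A B : 'M[R]_(m, n)) :
  frobsq (A - B) <= 2 * (frobsq A + frobsq B).
Proof. by rewrite -[frobsq B]frobsqN frobsqD. Qed.

Lemma frobsq_orthl m n p (Q : 'M[R]_(m, n)) (A : 'M[R]_(n, p)) :
  Q^T *m Q = 1%:M -> frobsq (Q *m A) = frobsq A.
Proof. by move=> QQ; rewrite !frobsqE trmx_mul -mulmxA (mulmxA Q^T) QQ mul1mx. Qed.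

Lemma orthoC n (Q : 'M[R]_n) : Q^T *m Q = 1%:M -> Q *m Q^T = 1%:M.
Proof. exact: mulmx1C. Qed.

Lemma frobsq_conj n (Q A : 'M[R]_n) :
  Q^T *m Q = 1%:M -> frobsq (Q *m A *m Q^T) = frobsq A.
Proof.
move=> QQ; rewrite -mulmxA frobsq_orthl // -frobsqT trmx_mul trmxK.
by rewrite frobsq_orthl // frobsqT.
Qed.

Lemma frobsq_col m n (A : 'M[R]_(m, n)) : frobsq A = \sum_j frobsq (col j A).
Proof.
rewrite /frobsq exchange_big; apply: eq_bigr => j _.
by apply: eq_bigr => i _; rewrite big_ord1 mxE.
Qed.

Definition dot n (x y : 'cV[R]_n) : R := (x^T *m y) 0 0.

Lemma dotE n (x y : 'cV[R]_n) : dot x y = \sum_i x i 0 * y i 0.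
Proof. by rewrite /dot mxE; apply: eq_bigr => i _; rewrite mxE. Qed.

Lemma dotC n (x y : 'cV[R]_n) : dot x y = dot y x.
Proof. by rewrite !dotE; apply: eq_bigr => i _; rewrite mulrC. Qed.

Lemma dotDl n (x y z : 'cV[R]_n) : dot (x + y) z = dot x z + dot y z.
Proof. by rewrite /dot linearD mulmxDl mxE. Qed.

Lemma dotZl n a (x z : 'cV[R]_n) : dot (a *: x) z = a * dot x z.
Proof. by rewrite /dot linearZ -scalemxAl mxE. Qed.

Lemma dot0l n (x : 'cV[R]_n) : dot 0 x = 0.
Proof. by rewrite /dot trmx0 mul0mx mxE. Qed.

Lemma dotNl n (x z : 'cV[R]_n) : dot (- x) z = - dot x z.
Proof. by rewrite -scaleN1r dotZl mulN1r. Qed.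

Lemma dotBl n (x y z : 'cV[R]_n) : dot (x - y) z = dot x z - dot y z.
Proof. by rewrite dotDl dotNl. Qed.

Lemma dotDr n (x y z : 'cV[R]_n) : dot z (x + y) = dot z x + dot z y.
Proof. by rewrite !(dotC z) dotDl. Qed.

Lemma dotZr n a (x z : 'cV[R]_n) : dot z (a *: x) = a * dot z x.
Proof. by rewrite !(dotC z) dotZl. Qed.

Lemma dotBr n (x y z : 'cV[R]_n) : dot z (x - y) = dot z x - dot z y.
Proof. by rewrite !(dotC z) dotBl. Qed.

Lemma dot_sumr n I (r : seq I) (P : pred I) (F : I -> 'cV[R]_n) z :
  dot z (\sum_(i <- r | P i) F i) = \sum_(i <- r | P i) dot z (F i).
Proof. by rewrite /dot mulmx_sumr summxE. Qed.

Lemma dot_mulmxr m n (A : 'M[R]_(m, n)) x y :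
  dot x (A *m y) = dot (A^T *m x) y.
Proof. by rewrite /dot trmx_mul trmxK mulmxA. Qed.

Lemma frobsq_dot n (x : 'cV[R]_n) : frobsq x = dot x x.
Proof. by rewrite frobsqE /mxtrace big_ord1. Qed.

Lemma dot_ge0 n (x : 'cV[R]_n) : 0 <= dot x x.
Proof. by rewrite -frobsq_dot frobsq_ge0. Qed.

Lemma dot_eq0 n (x : 'cV[R]_n) : dot x x = 0 -> x = 0.
Proof. by rewrite -frobsq_dot => /frobsq_eq0. Qed.

(** Expands the squared length of [dot y y *: x - dot x y *: y]. *)
Lemma dot_cauchy n (x y : 'cV[R]_n) : dot x y ^+ 2 <= dot x x * dot y y.
Proof.
have [/dot_eq0 ->|y0] := eqVneq (dot y y) 0.
  by rewrite /dot trmx0 mul0mx mulmx0 !mxE expr0n mulr0.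
have yp : 0 < dot y y by rewrite lt_def y0 dot_ge0.
have := dot_ge0 (dot y y *: x - dot x y *: y).
rewrite dotBl !dotBr !dotZl !dotZr (dotC y x) => h.
rewrite -(ler_pM2l yp); nra.
Qed.

Lemma dot_delta n (x : 'cV[R]_n) i : dot (delta_mx i 0) x = x i 0.
Proof.
rewrite dotE (bigD1 i) //= big1 ?addr0 ?mxE ?eqxx ?mul1r // => j ji.
by rewrite mxE (negPf ji) mul0r.
Qed.

Lemma mulmx_dot m n (A : 'M[R]_(n, m)) (B : 'M[R]_(n, m)) i j :
  (A^T *m B) i j = dot (col i A) (col j B).
Proof. by rewrite dotE mxE; apply: eq_bigr => l _; rewrite !mxE. Qed.

Lemma col_mulmx m n p (A : 'M[R]_(m, n)) (B : 'M[R]_(n, p)) j :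
  col j (A *m B) = A *m col j B.
Proof. by rewrite !colE mulmxA. Qed.

Lemma mxtrace_quad m n (A : 'M[R]_n) (W : 'M[R]_(n, m)) :
  \tr (W^T *m A *m W) = \sum_i dot (col i W) (A *m col i W).
Proof.
by apply: eq_bigr => i _; rewrite -mulmxA mulmx_dot -col_mulmx.
Qed.

(** Spectral norm at most 1, phrased without a supremum or a root. *)
Definition contraction n (A : 'M[R]_n) :=
  forall x : 'cV[R]_n, frobsq (A *m x) <= frobsq x.

Lemma contraction_mull m n (A : 'M[R]_n) (B : 'M[R]_(n, m)) :
  contraction A -> frobsq (A *m B) <= frobsq B.
Proof.
move=> cA; rewrite !frobsq_col; apply: ler_sum => j _.
by rewrite col_mulmx.
Qed.

Lemma contraction_mulr m n (A : 'M[R]_n) (B : 'M[R]_(m, n)) :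
  A^T = A -> contraction A -> frobsq (B *m A) <= frobsq B.
Proof.
by move=> sA cA; rewrite -frobsqT trmx_mul sA -[frobsq B]frobsqT contraction_mull.
Qed.

Lemma frobsq1 n : frobsq (1%:M : 'M[R]_n) = n%:R.
Proof. by rewrite frobsqE trmx1 mulmx1 mxtrace1. Qed.

Lemma contraction_frobsq n (A : 'M[R]_n) : contraction A -> frobsq A <= n%:R.
Proof. by move=> cA; rewrite -[A]mulmx1 -frobsq1 contraction_mull. Qed.

Lemma contraction_conj n (Q A : 'M[R]_n) :
  Q^T *m Q = 1%:M -> contraction A -> contraction (Q *m A *m Q^T).
Proof.
move=> QQ cA x; rewrite -2!mulmxA frobsq_orthl // (le_trans (cA _)) //.
by rewrite frobsq_orthl // trmxK orthoC.
Qed.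

Lemma frobsq_mulmx_col n (A : 'M[R]_n) (x : 'cV[R]_n) :
  frobsq (A *m x) <= frobsq A * frobsq x.
Proof.
rewrite /frobsq big_distrl; apply: ler_sum => i _; rewrite big_ord1.
have -> : (A *m x) i 0 = dot (row i A)^T x.
  by rewrite dotE mxE; apply: eq_bigr => j _; rewrite !mxE.
apply: (le_trans (dot_cauchy _ _)); rewrite -!frobsq_dot.
rewrite frobsqT ler_wpM2r ?frobsq_ge0 // {1}/frobsq big_ord1.
by apply: ler_sum => j _; rewrite mxE.
Qed.
End Basics.

(** * Maximising frames and the spectral theorem *)

Section Stiefel.
Context {R : realType}.

Lemma cvg_bigsum T (F : set_system T) {FF : Filter F} I (r : seq I)
    (f : I -> T -> R) (a : I -> R) :
  (forall i, f i x @[x --> F] --> a i) ->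
  \sum_(i <- r) f i x @[x --> F] --> \sum_(i <- r) a i.
Proof.
move=> fa; elim: r => [|i r IHr].
  under eq_fun do rewrite big_nil.
  by rewrite big_nil; exact: cvg_cst.
under eq_fun do rewrite big_cons.
by rewrite big_cons; apply: cvgD; [exact: fa|exact: IHr].
Qed.

Definition orthonormal k d (v : 'I_k -> 'cV[R]_d) :=
  forall a b, dot (v a) (v b) = (a == b)%:R.

Definition frame_value k d (c : 'I_k -> 'M[R]_d) (v : 'I_k -> 'cV[R]_d) : R :=
  \sum_i dot (v i) (c i *m v i).

Definition frame_max k d (c : 'I_k -> 'M[R]_d) (v : 'I_k -> 'cV[R]_d) :=
  orthonormal v /\
  forall u, orthonormal u -> frame_value c u <= frame_value c v.

Lemma orthonormal_coord k d (v : 'I_k -> 'cV[R]_d) a i :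
  orthonormal v -> v a i 0 ^+ 2 <= 1.
Proof.
move=> ov; have <- : dot (v a) (v a) = 1 by rewrite ov eqxx.
rewrite dotE (bigD1 i) //=.
by rewrite -expr2 lerDl sumr_ge0 // => j _; rewrite -expr2 sqr_ge0.
Qed.

(** The orthonormal frames form a closed and bounded set and the frame value is polynomial in the
    coordinates, so a maximum is attained; [v0] makes the set nonempty. *)
Lemma frame_max_exists k d (c : 'I_k -> 'M[R]_d) (v0 : 'I_k -> 'cV[R]_d) :
  orthonormal v0 -> exists v, frame_max c v.
Proof.
move=> ov0.
(* Frames are flattened to row vectors, where products of segments are known to be compact. *)
pose fr (r : 'rV[R]_(k * d)) (a : 'I_k) : 'cV[R]_d := (row a (vec_mx r))^T.
pose cd (v : 'I_k -> 'cV[R]_d) : 'rV[R]_(k * d) :=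
  mxvec (\matrix_(a, i) v a i 0).
have frK v : fr (cd v) = v.
  by apply/funext => a; apply/colP => i; rewrite /fr /cd mxvecK !mxE.
have frC a i : continuous (fun r => fr r a i 0).
  move=> r; have -> : (fun r => fr r a i 0) = fun r => r 0 (mxvec_index a i).
    by apply/funext => s; rewrite !mxE.
  exact: coord_continuous.
have dotC a b r : dot (fr s a) (fr s b) @[s --> r] --> dot (fr r a) (fr r b).
  under eq_fun do rewrite dotE.
  by rewrite dotE; apply: (cvg_bigsum (F := nbhs r)) => i; apply: cvgM; exact: frC.
have valC r : frame_value c (fr s) @[s --> r] --> frame_value c (fr r).
  apply: (cvg_bigsum (F := nbhs r)) => a; under eq_fun do rewrite dotE.
  rewrite dotE; apply: (cvg_bigsum (F := nbhs r)) => i; apply: cvgM; first exact: frC.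
  under eq_fun do rewrite mxE.
  rewrite mxE; apply: (cvg_bigsum (F := nbhs r)) => j.
  by apply: cvgM; [exact: cvg_cst | exact: frC].
pose A := [set r | orthonormal (fr r)].
have Acl : closed A.
  have -> : A = \bigcap_(ab in [set: 'I_k * 'I_k])
      ((fun r => dot (fr r ab.1) (fr r ab.2)) @^-1`
        [set (ab.1 == ab.2)%:R]).
    apply/seteqP; split => [r Ar [a b] _|r Ar a b]; first exact: Ar.
    exact: (Ar (a, b) I).
  apply: closed_bigI => -[a b] _; apply: preimage_closed.
    by move=> r _; exact: dotC.
  exact: closed_eq.
have Acpt : compact A.
  have := @rV_compact R (k * d) (fun=> `[(- 1), 1]%classic)
    (fun=> @segment_compact R (-1) 1).
  move=> cpt; apply: (subclosed_compact Acl cpt) => r Ar l /=.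
  case/mxvec_indexP: l => a i.
  have := orthonormal_coord a i Ar; rewrite !mxE /= => h.
  by rewrite in_itv /=; apply/andP; split; nra.
have A0 : A !=set0 by exists (cd v0); rewrite /A /= frK.
have [r rA rmax] := EVT_max_rV A0 Acpt (continuous_subspaceT valC).
exists (fr r); split; first by rewrite inE in rA.
move=> u ou; have := rmax (cd u); rewrite frK; apply.
by rewrite inE /A /= frK.
Qed.

(** A quadratic form on the unit circle that is maximal at [(1, 0)] has zero derivative there, and
    this derivative is [B]. The circle is parametrised rationally by [c = (1 - t^2) / (1 + t^2)] and
    [s = 2 t / (1 + t^2)]. *)
Lemma rotation_critical (A B C : R) :
  (forall c s, c ^+ 2 + s ^+ 2 = 1 ->
     A * c ^+ 2 + B * (c * s) + C * s ^+ 2 <= A) -> B = 0.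
Proof.
move=> h.
have key t : B * (1 - t ^+ 2) * t <= 2 * (A - C) * t ^+ 2.
  have t1 : 0 < 1 + t ^+ 2 by rewrite ltr_pwDl ?sqr_ge0.
  have t10 : 1 + t ^+ 2 != 0 by rewrite gt_eqF.
  have := h ((1 - t ^+ 2) / (1 + t ^+ 2)) (2 * t / (1 + t ^+ 2)).
  have -> : ((1 - t ^+ 2) / (1 + t ^+ 2)) ^+ 2 +
     (2 * t / (1 + t ^+ 2)) ^+ 2 = 1 by field.
  move=> /(_ erefl) le1.
  have : (A * ((1 - t ^+ 2) / (1 + t ^+ 2)) ^+ 2 +
     B * ((1 - t ^+ 2) / (1 + t ^+ 2) * (2 * t / (1 + t ^+ 2))) +
     C * (2 * t / (1 + t ^+ 2)) ^+ 2) * (1 + t ^+ 2) ^+ 2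
     <= A * (1 + t ^+ 2) ^+ 2.
    by rewrite ler_wpM2r ?sqr_ge0.
  have -> : (A * ((1 - t ^+ 2) / (1 + t ^+ 2)) ^+ 2 +
     B * ((1 - t ^+ 2) / (1 + t ^+ 2) * (2 * t / (1 + t ^+ 2))) +
     C * (2 * t / (1 + t ^+ 2)) ^+ 2) * (1 + t ^+ 2) ^+ 2
     = A * (1 - t ^+ 2) ^+ 2 + 2 * B * (1 - t ^+ 2) * t + 4 * C * t ^+ 2.
    by field.
  by move=> le2; nra.
apply/eqP; apply: contraT => B0.
have Bp : 0 < `|B| by rewrite normr_gt0.
pose e := `|A - C| + 1.
have ep : 1 <= e by rewrite lerDr normr_ge0.
have eAC : A - C <= e - 1 by rewrite /e addrK ler_norm.
(* With this value [t0 <= 1/4] and [2 * (A - C) * t0 < |B| / 2], which contradicts [key] at [t0] or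
   at [- t0], according to the sign of [B]. *)
pose t0 := `|B| / (4 * (`|B| + e)).
have t0p : 0 < t0 by rewrite divr_gt0 // mulr_gt0 // addr_gt0 //; lra.
have t0E : t0 * (4 * (`|B| + e)) = `|B|.
  by rewrite mulfVK // gt_eqF // mulr_gt0 // addr_gt0 //; lra.
have t01 : t0 <= 4^-1 by nra.
have t02 : t0 ^+ 2 <= 4^-1 by nra.
have : `|B| * (1 - t0 ^+ 2) <= 2 * (A - C) * t0.
  have := key t0; have := key (- t0); rewrite sqrrN.
  move=> h1 h2; rewrite -(ler_pM2r t0p).
  by have [Bs|Bs] := leP 0 B; rewrite ?(ger0_norm Bs) ?(ltr0_norm Bs); nra.
by nra.
Qed.

(** Rotating [v i] and [v j] in their common plane keeps the frame orthonormal; the cross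
    coefficient of the resulting quadratic form is twice the difference of the two sides. *)
Lemma frame_critical k d (c : 'I_k -> 'M[R]_d) (v : 'I_k -> 'cV[R]_d) i j :
  (forall i, symmetric_mx (c i)) -> frame_max c v ->
  dot (v i) (c i *m v j) = dot (v i) (c j *m v j).
Proof.
move=> sc [ov vmax].
have [->//|ij] := eqVneq i j.
have ji : j != i by rewrite eq_sym.
have sC l x y : dot x (c l *m y) = dot y (c l *m x).
  by rewrite dot_mulmxr sc dotC.
suff : 2 * (dot (v i) (c i *m v j) - dot (v i) (c j *m v j)) = 0.
  by move/eqP; rewrite mulf_eq0 pnatr_eq0 /= subr_eq0 => /eqP.
apply: (@rotation_critical (dot (v i) (c i *m v i) + dot (v j) (c j *m v j))
  _ (dot (v j) (c i *m v j) + dot (v i) (c j *m v i))) => C S CS1.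
pose u l := if l == i then C *: v i + S *: v j
            else if l == j then C *: v j - S *: v i else v l.
have ou : orthonormal u.
  move=> a b; rewrite /u.
  case: (boolP (a == i)) => [/eqP->|ai]; case: (boolP (b == i)) => [/eqP bi|bi];
    rewrite ?bi /=.
  - by rewrite !dotDl !dotDr !dotZl !dotZr !ov !eqxx (negPf ij) (negPf ji) /=; lra.
  - case: (boolP (b == j)) => [/eqP->|bj].
      by rewrite dotDl !dotBr !dotZl !dotZr !ov !eqxx (negPf ij) (negPf ji) /=; lra.
    rewrite dotDl !dotZl !ov (eq_sym i b) (eq_sym j b) (negPf bi) (negPf bj).
    by rewrite !mulr0 addr0.
  - case: (boolP (a == j)) => [/eqP->|aj].
      by rewrite dotBl !dotDr !dotZl !dotZr !ov !eqxx (negPf ij) (negPf ji) /=; lra.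
    by rewrite dotDr !dotZr !ov (negPf ai) (negPf aj) !mulr0 addr0.
  - case: (boolP (a == j)) => [/eqP->|aj]; case: (boolP (b == j)) => [/eqP->|bj].
    + by rewrite !dotBl !dotBr !dotZl !dotZr !ov !eqxx (negPf ij) (negPf ji) /=; lra.
    + rewrite dotBl !dotZl !ov (eq_sym i b) (eq_sym j b) (negPf bi) (negPf bj).
      by rewrite !mulr0 subr0.
    + by rewrite dotBr !dotZr !ov (negPf ai) (negPf aj) !mulr0 subr0.
    + exact: ov.
have := vmax u ou; rewrite /frame_value.
rewrite (bigD1 i) // (bigD1 j) //= [X in _ <= X](bigD1 i) //.
rewrite [X in _ <= _ + X](bigD1 j) //=.
rewrite (eq_bigr (fun l => dot (v l) (c l *m v l))); last first.
  by move=> l /andP[li lj]; rewrite /u (negPf li) (negPf lj).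
rewrite !addrA lerD2r /u eqxx (negPf ji) eqxx.
rewrite mulmxBr mulmxDr -!scalemxAr dotBl dotDl !dotZl !dotBr !dotDr !dotZr.
rewrite (sC i (v j) (v i)) (sC j (v j) (v i)) => h.
by apply: le_trans h; lra.
Qed.

(** Otherwise the part [w] of [c i *m v i] orthogonal to the frame is nonzero, and rotating [v i]
    towards [w] has derivative twice the length of [w]. *)
Lemma frame_critical_orth k d (c : 'I_k -> 'M[R]_d) (v : 'I_k -> 'cV[R]_d) i :
  (forall i, symmetric_mx (c i)) -> frame_max c v ->
  c i *m v i = \sum_j dot (v j) (c i *m v i) *: v j.
Proof.
move=> sc [ov vmax].
have sC l x y : dot x (c l *m y) = dot y (c l *m x).
  by rewrite dot_mulmxr sc dotC.
pose p := \sum_j dot (v j) (c i *m v i) *: v j.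
pose w := c i *m v i - p.
have wv j : dot (v j) w = 0.
  rewrite dotBr dot_sumr (bigD1 j) //= dotZr ov eqxx mulr1 big1 ?addr0 ?subrr //.
  by move=> l lj; rewrite dotZr ov eq_sym (negPf lj) mulr0.
suff : dot w w = 0 by move/dot_eq0/eqP; rewrite subr_eq0 => /eqP.
apply/eqP; apply: contraT => w0.
have wp : 0 < dot w w by rewrite lt_def w0 dot_ge0.
pose n := Num.sqrt (dot w w).
have np : 0 < n by rewrite sqrtr_gt0.
have n2 : n ^+ 2 = dot w w by rewrite sqr_sqrtr // ltW.
pose w' := n^-1 *: w.
have w'v j : dot (v j) w' = 0 by rewrite dotZr wv mulr0.
have w'w' : dot w' w' = 1.
  by rewrite dotZl dotZr -n2; field; rewrite gt_eqF.
have wcv : dot w (c i *m v i) = dot w w.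
  have -> : c i *m v i = w + p by rewrite subrK.
  rewrite dotDr [X in _ + X]dot_sumr big1 ?addr0 // => j _.
  by rewrite dotZr (dotC w) wv mulr0.
suff : 2 * dot w' (c i *m v i) = 0.
  rewrite dotZl wcv -n2 => /eqP; rewrite mulf_eq0 pnatr_eq0 /= expr2 mulKf.
    by rewrite gt_eqF.
  by rewrite gt_eqF.
clearbody w'.
apply: (@rotation_critical (dot (v i) (c i *m v i)) _
  (dot w' (c i *m w'))) => C S CS1.
pose u l := if l == i then C *: v i + S *: w' else v l.
have ou : orthonormal u.
  move=> a b; rewrite /u.
  case: (boolP (a == i)) => [/eqP->|ai]; case: (boolP (b == i)) => [/eqP bi|bi];
    rewrite ?bi /=.
  - by rewrite !dotDl !dotDr !dotZl !dotZr (dotC w' (v i)) !w'v w'w' ov eqxx /=; lra.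
  - rewrite dotDl !dotZl ov (dotC w' (v b)) w'v eq_sym (negPf bi).
    by rewrite !mulr0 addr0.
  - by rewrite dotDr !dotZr ov w'v (negPf ai) !mulr0 addr0.
  - exact: ov.
have := vmax u ou; rewrite /frame_value.
rewrite (bigD1 i) //= [X in _ <= X](bigD1 i) //=.
rewrite (eq_bigr (fun l => dot (v l) (c l *m v l))); last first.
  by move=> l li; rewrite /u (negPf li).
rewrite lerD2r /u eqxx.
rewrite !mulmxDr -!scalemxAr !dotDl !dotZl !dotDr.
rewrite !dotZr (sC i (v i) w') => h.
by apply: le_trans h; lra.
Qed.

Lemma orthonormal_delta d : orthonormal (fun i : 'I_d => delta_mx i 0).
Proof. by move=> a b; rewrite dot_delta mxE eqxx andbT. Qed.

(* A maximiser of sum_i i * (v_i' A v_i) over orthonormal bases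
   diagonalises A. *)
Lemma spectral_symmetric d (A : 'M[R]_d) : symmetric_mx A ->
  exists Q : 'M[R]_d, exists l : 'rV[R]_d,
    Q^T *m Q = 1%:M /\ Q^T *m A *m Q = diag_mx l.
Proof.
move=> sA; pose c (i : 'I_d) := (i : nat)%:R *: A.
have sc i : symmetric_mx (c i) by rewrite /symmetric_mx linearZ /= sA.
have [v vmax] := frame_max_exists c (@orthonormal_delta d).
(* Criticality for the weights [i] and [j] reads [i * dot (v i) (A *m v j) = j * dot (v i) (A *m v
   j)], and the weights are distinct. *)
have off i j : i != j -> dot (v i) (A *m v j) = 0.
  move=> ij; have := frame_critical i j sc vmax.
  rewrite -!scalemxAl !dotZr => /eqP; rewrite -subr_eq0 -mulrBl mulf_eq0.
  by rewrite subr_eq0 eqr_nat (inj_eq val_inj) (negPf ij) => /eqP.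
pose Q : 'M[R]_d := \matrix_(i, j) v j i 0.
have cQ j : col j Q = v j by apply/colP => i; rewrite !mxE.
exists Q, (\row_j dot (v j) (A *m v j)); split.
  by apply/matrixP => i j; rewrite mulmx_dot !cQ vmax.1 mxE.
apply/matrixP => i j; rewrite -mulmxA mulmx_dot col_mulmx !cQ !mxE.
by have [->|ij] := eqVneq i j; rewrite ?mulr1n ?mulr0n // off.
Qed.

(** The eigenvalues are values of the quadratic form at eigenvectors, hence nonnegative; their
    square roots scale the columns of the eigenbasis. *)
Lemma psd_factor d (X : 'M[R]_d) : psd X ->
  exists B : 'M[R]_d, X = B *m B^T.
Proof.
move=> [sX pX]; have [Q [l [QQ QX]]] := spectral_symmetric sX.
have l0 i : 0 <= l 0 i.
  have := pX (Q *m delta_mx i 0).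
  rewrite trmx_mul -!mulmxA (mulmxA X) (mulmxA Q^T) (mulmxA Q^T) QX.
  by rewrite -/(dot _ _) dot_delta mul_diag_mx !mxE !eqxx mulr1.
exists (Q *m diag_mx (\row_i Num.sqrt (l 0 i))).
rewrite trmx_mul tr_diag_mx mulmxA -(mulmxA Q) mulmx_diag.
have -> : \row_j ((\row_i Num.sqrt (l 0 i)) 0 j * (\row_i Num.sqrt (l 0 i)) 0 j) = l.
  by apply/rowP => i; rewrite !mxE -expr2 sqr_sqrtr.
by rewrite -QX !mulmxA orthoC // mul1mx -mulmxA orthoC // mulmx1.
Qed.
End Stiefel.

(** * Strictly complementary duals of the assignment LP *)

Section Assignment.
Context {R : realType}.

(** Complementary slackness up to [e]: at the prices [y] each row gets a column whose net value is
    within [e] of the best one, and unassigned columns are free. *)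
Definition equilibrium k d (m : 'I_k -> 'I_d -> R) (e : R)
    (s : 'I_k -> 'I_d) (y : 'I_d -> R) :=
  [/\ injective s, forall j, 0 <= y j, forall j, j \notin codom s -> y j = 0
    & forall i j, m i j - y j <= m i (s i) - y (s i) + e].

(* Bertsekas' auction: an unassigned row takes over its best column and raises
   that column's price by e.  Since k < d some column is still free of charge,
   so prices stay bounded and the process stops. *)
Lemma equilibrium_exists k d (m : 'I_k -> 'I_d -> R) (e : R) :
  (k < d)%N -> 0 < e -> exists s y, equilibrium m e s y.
Proof.
move=> kd e0.
(* [e * B] exceeds every difference of values within a row, so [B] bids per column suffice. *)
have [B BP] : exists B : nat, forall i j j', m i j - m i j' < e * B%:R.
  pose M := \sum_i \sum_j `|m i j|.
  exists (Num.bound (2 * M / e)) => i j j'.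
  have mM j0 : `|m i j0| <= M.
    rewrite /M (bigD1 i) //= (bigD1 j0) //= -addrA lerDl addr_ge0 ?sumr_ge0 //.
    by move=> i0 _; rewrite sumr_ge0.
  have h : 2 * M / e < (Num.bound (2 * M / e))%:R.
    rewrite archi_boundP // divr_ge0 ?(ltW e0) // mulr_ge0 //.
    by apply: sumr_ge0 => i0 _; exact: sumr_ge0.
  rewrite mulrC -ltr_pdivrMr //; apply: le_lt_trans h.
  rewrite ler_pM2r ?invr_gt0 //.
  have := mM j; have := mM j'; rewrite !ler_norml; lra.
(* Invariant of the auction: [f] is a partial assignment, [e * n j] the price of column [j]. A
   column that ever received a bid stays assigned. *)
pose inv (f : 'I_k -> option 'I_d) (n : 'I_d -> nat) :=
  [/\ forall i i' j, f i = Some j -> f i' = Some j -> i = i',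
      forall j, (0 < n j)%N -> exists i, f i = Some j,
      forall j, (n j <= B)%N
    & forall i j j', f i = Some j ->
        m i j' - e * (n j')%:R <= m i j - e * (n j)%:R + e].
(* Each bid lowers [\sum_j (B - n j)], which bounds the number of rounds. *)
suff run N : forall f n, inv f n -> (\sum_j (B - n j) < N)%N ->
    exists s y, equilibrium m e s y.
  apply: (run (\sum_(j < d) (B - 0)).+1 (fun=> None) (fun=> 0%N)) => //.
elim: N => [//|N IHN] f n [finj nass nB fopt] lN.
have [/existsP[i /eqP fi]|] := boolP [exists i, f i == None]; last first.
  move=> /existsPn fS.
  have /choice[s sP] : forall i, exists j, f i = Some j.
    move=> i; have := fS i; case: (f i) => // j _; by exists j.
  exists s, (fun j => e * (n j)%:R); split.
  - by move=> i i' ss; apply: (finj i i' (s i)); rewrite sP // ss.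
  - by move=> j; rewrite mulr_ge0 // ltW.
  - move=> j jn; have [/nass[i]|] := ltnP 0 (n j).
      by rewrite sP => -[sij]; rewrite -sij codom_f in jn.
    by rewrite leqn0 => /eqP ->; rewrite mulr0.
  - by move=> i j; exact: fopt.
have [j0 j0P] : exists j, forall i, f i != Some j.
  apply: contrapT => hn.
  have /choice[g gP] : forall j, exists i, f i = Some j.
    move=> j; apply: contrapT => hj; apply: hn; exists j => i'.
    by apply/eqP => fi'; apply: hj; exists i'.
  have ginj : injective g.
    by move=> j j' gg; have := gP j; rewrite gg gP => -[].
  by have := leq_card g ginj; rewrite !card_ord leqNgt kd.
have nj0 : n j0 = 0%N.
  by apply/eqP; rewrite -leqn0 leqNgt; apply/negP => /nass[i' /eqP];
     rewrite (negPf (j0P i')).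
pose F j := m i j - e * (n j)%:R.
case: (@arg_maxP _ _ _ j0 xpredT F isT) => j _ jmax.
(* The best column [j] is at least as good as the free column [j0], so its price is still below the
   bound. *)
have njB : (n j < B)%N.
  have h : m i j0 - e * (n j0)%:R <= m i j - e * (n j)%:R by exact: jmax.
  rewrite nj0 mulr0 subr0 in h.
  rewrite -(ltr_nat R) -(ltr_pM2l e0); apply: le_lt_trans (BP i j j0); lra.
(* Row [i] takes [j] and evicts a previous owner; after the raise by [e], column [j] is still within
   [e] of the best for [i]. *)
pose f' x := if x == i then Some j else if f x == Some j then None else f x.
pose n' x := (n x + (x == j))%N.
have nn' x : e * (n x)%:R <= e * (n' x)%:R.
  by rewrite ler_pM2l // ler_nat leq_addr.
have f'S x l : x != i -> f' x = Some l -> l != j /\ f x = Some l.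
  rewrite /f' => /negPf ->; case: eqP => // fx fxl; split => //.
  by apply/eqP => lj; apply: fx; rewrite fxl lj.
apply: (IHN f' n').
  split.
  - move=> x x' l; have [->|xi] := eqVneq x i; have [->//|x'i] := eqVneq x' i.
    + rewrite {1}/f' eqxx => -[<-] /(f'S _ _ x'i)[].
      by rewrite eqxx.
    + move=> /(f'S _ _ xi)[lj _]; rewrite /f' eqxx => -[jl].
      by rewrite jl eqxx in lj.
    + by move=> /(f'S _ _ xi)[_ fx] /(f'S _ _ x'i)[_ fx']; exact: finj fx fx'.
  - move=> l; have [->|lj] := eqVneq l j; first by exists i; rewrite /f' eqxx.
    rewrite /n' (negPf lj) addn0 => /nass[x fx]; exists x.
    have xi : x != i by apply/eqP => xi; rewrite xi fi in fx.
    by rewrite /f' (negPf xi) fx; case: eqP => // -[ljE]; rewrite ljE eqxx in lj.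
  - move=> l; rewrite /n'; have [->|lj] := eqVneq l j; first by rewrite addn1.
    by rewrite addn0.
  - move=> x l j'; have [->|xi] := eqVneq x i.
      rewrite {1}/f' eqxx => -[<-].
      have : m i j' - e * (n j')%:R <= m i j - e * (n j)%:R by exact: jmax.
      have -> : (n' j)%:R = (n j)%:R + 1 :> R by rewrite /n' eqxx natrD.
      by have := nn' j'; rewrite mulrDr mulr1; lra.
    move=> /(f'S _ _ xi)[lj fx]; have := fopt x l j' fx; have := nn' j'.
    have -> : n' l = n l by rewrite /n' (negPf lj) addn0.
    by lra.
have : (\sum_l (B - n' l) < \sum_l (B - n l))%N.
  rewrite (bigD1 j) //= [X in (_ < X)%N](bigD1 j) //= /n' eqxx addn1.
  rewrite (eq_bigr (fun l => B - n l)%N) ?ltn_add2r ?ltn_sub2l //.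
  by move=> l /negPf ->; rewrite addn0.
by move=> h; apply: leq_trans h _.
Qed.

Lemma sum_codom k d (s : 'I_k -> 'I_d) (y : 'I_d -> R) : injective s ->
  (forall j, j \notin codom s -> y j = 0) -> \sum_j y j = \sum_i y (s i).
Proof.
move=> sinj y0; rewrite (bigID [pred j in s @: 'I_k]) /= big_imset /=; last first.
  by move=> i i' _ _; exact: sinj.
rewrite [X in _ + X]big1 ?addr0; first by [].
move=> j js; apply: y0; apply: contra js => /codomP[i ->].
by rewrite imset_f.
Qed.

(** Weak duality: the prices [y] and the profits [m i (s i) - y (s i) + e] form a dual feasible
    solution, whose value exceeds that of [s] by [k * e]. *)
Lemma equilibrium_bound k d m e s y (x : 'I_k -> 'cV[R]_d) :
  equilibrium m e s y -> lp_feasible x ->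
  \sum_i \sum_j m i j * x i j 0 <= \sum_i m i (s i) + k%:R * e.
Proof.
move=> [sinj y0 yoff eq] [x0 x1 xc].
have step i : \sum_j m i j * x i j 0 <=
    m i (s i) - y (s i) + e + \sum_j y j * x i j 0.
  rewrite -[X in X + _]mulr1 -(x1 i) big_distrr -big_split /=.
  apply: ler_sum => j _; rewrite -mulrDl ler_wpM2r //.
  by have := eq i j; lra.
apply: (le_trans (ler_sum _ (fun i _ => step i))).
rewrite big_split /= exchange_big /=.
have : \sum_j \sum_i y j * x i j 0 <= \sum_i y (s i).
  rewrite -(sum_codom sinj yoff); apply: ler_sum => j _.
  by rewrite -big_distrr -[leRHS]mulr1 /= ler_wpM2l.
rewrite big_split /= sumrB sumr_const card_ord -mulr_natl; lra.
Qed.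

Lemma finite_gap (T : finType) (P : pred T) (f : T -> R) c :
  (forall t, P t -> f t < c) ->
  exists2 g, 0 < g & forall t, P t -> f t + g <= c.
Proof.
(* The default 1 keeps the gap positive when nothing satisfies [P]. *)
move=> fc; exists (\big[Num.min/1]_(t | P t) (c - f t)).
  by apply: lt_bigmin => [|t Pt]; [exact: ltr01 | rewrite subr_gt0 fc].
by move=> t Pt; have := bigmin_le_cond 1 (fun t => c - f t) Pt; lra.
Qed.

(** Uniqueness lets the best injection [s] beat all others by a gap. Increasing all weights off [s]
    slightly does not change the winner, so an equilibrium for the increased weights leaves strict
    slack off [s] for the original ones. *)
Lemma strict_dual k d (m : 'I_k -> 'cV[R]_d) :
  (k < d)%N -> lp_unique_optimum m ->
  exists (s : 'I_k -> 'I_d) (lam : 'I_k -> R) (y : 'I_d -> R) (g : R),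
    [/\ injective s /\ 0 < g, forall i, lam i + y (s i) = m i (s i) 0,
        forall i j, j != s i -> m i j 0 + g <= lam i + y j,
        forall i, g <= y (s i) & forall j, j \notin codom s -> y j = 0].
Proof.
move=> kd [x0 [_ xuniq]].
pose xs (s : {ffun 'I_k -> 'I_d}) i : 'cV[R]_d := delta_mx (s i) 0.
pose w (s : {ffun 'I_k -> 'I_d}) := \sum_i m i (s i) 0.
have objE (x : 'I_k -> 'cV[R]_d) :
    lp_objective m x = \sum_i \sum_j m i j 0 * x i j 0.
  by apply: eq_bigr => i _; rewrite -/(dot _ _) dotE.
have xsE s i j : xs s i j 0 = (j == s i)%:R by rewrite !mxE eqxx andbT.
have xsum (a : 'I_d -> R) s i : \sum_j a j * xs s i j 0 = a (s i).
  rewrite (bigD1 (s i)) //= xsE eqxx mulr1 big1 ?addr0 // => j /negPf ji.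
  by rewrite xsE ji mulr0.
have xsF (s : {ffun 'I_k -> 'I_d}) : injective s -> lp_feasible (xs s).
  move=> sinj; split => [i j|i|j]; first by rewrite xsE.
    by rewrite -(xsum (fun=> 1) s i); apply: eq_bigr => j _; rewrite mul1r.
  have [/existsP[i /eqP js]|/existsPn js] := boolP [exists i, j == s i].
    rewrite (bigD1 i) //= big1 ?addr0 ?xsE ?js ?eqxx // => i' i'i.
    by rewrite xsE (inj_eq sinj) eq_sym (negPf i'i).
  by rewrite big1 ?ler01 // => i _; rewrite xsE (negPf (js i)).
pose s0 := [ffun i : 'I_k => widen_ord (ltnW kd) i].
have s0P : injectiveb s0.
  by apply/injectiveP => i i'; rewrite !ffunE => /(congr1 val) /= /val_inj.
case: (@arg_maxP _ _ _ s0 (fun s : {ffun 'I_k -> 'I_d} => injectiveb s) w s0P)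
  => s /injectiveP sinj smax.
(* Integrality of the LP: equilibria with arbitrarily small error bound every fractional value by
   the value of an injection. *)
have opt (t : {ffun 'I_k -> 'I_d}) : injective t -> w s <= w t ->
    lp_optimal m (xs t).
  move=> tinj st; split; first exact: xsF.
  move=> x xF; rewrite !objE; under [leRHS]eq_bigr do rewrite xsum.
  apply: le_trans st; apply/ler_addgt0Pr => e e0.
  have ek : 0 < e / k.+1%:R by rewrite divr_gt0.
  have [r [y eqr]] := equilibrium_exists (fun i j => m i j 0) kd ek.
  apply: (le_trans (equilibrium_bound eqr xF)).
  have rinj : injective [ffun i => r i].
    by move=> i i'; rewrite !ffunE; case: eqr => rinj _ _ _; exact: rinj.
  have : w [ffun i => r i] <= w s by apply: smax; apply/injectiveP.
  have -> : w [ffun i => r i] = \sum_i m i (r i) 0.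
    by apply: eq_bigr => i _; rewrite ffunE.
  have : k%:R * (e / k.+1%:R) <= e.
    by rewrite mulrC -mulrA ger_pMr // mulrC ler_pdivrMr // mul1r ler_nat.
  by move=> /= ke rs; rewrite addrC -lerBrDr; apply: (le_trans ke); lra.
(* An injection at least as good as [s] would be a second LP optimum. *)
have lt_s (t : {ffun 'I_k -> 'I_d}) : injectiveb t && (t != s) -> w t < w s.
  case/andP => /injectiveP tinj ts; rewrite ltNge; apply: contra ts => st.
  have xst : xs t = xs s.
    by rewrite -(xuniq _ (opt t tinj st)) -(xuniq _ (opt s sinj (lexx _))).
  apply/eqP/ffunP => i; apply/eqP; have := xsE t i (t i).
  by rewrite xst xsE eqxx; case: eqP => // _ /eqP; rewrite eq_sym oner_eq0.
have [g g0 gP] := finite_gap lt_s.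
(* The increase of the weights costs at most [k * h] and the equilibrium error [k * h / 2]; together
   they stay below [g]. *)
pose h := g / (2 * k.+1%:R).
have h0 : 0 < h by rewrite divr_gt0 // mulr_gt0.
have kh : k%:R * (2 * h) <= g - 2 * h.
  have -> : g = k.+1%:R * (2 * h).
    by rewrite /h mulrA [k.+1%:R * 2]mulrC [RHS]mulrC divfK.
  by rewrite -natr1; lra.
pose m' i j := m i j 0 + h * (j != s i)%:R.
have h20 : 0 < h / 2 by rewrite divr_gt0.
have [r [y eqr]] := equilibrium_exists m' kd h20.
have [rinj y0 yoff yeq] := eqr.
have rs : r = s.
  pose t := [ffun i => r i].
  suff ts : t = s by apply/funext => i; rewrite -ts ffunE.
  apply/eqP; apply: contraT => ts.
  have tinj : injective t by move=> i i'; rewrite !ffunE => /rinj.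
  have := equilibrium_bound eqr (xsF s sinj).
  under eq_bigr do rewrite xsum /m' eqxx mulr0 addr0.
  have tI : injectiveb t && (t != s) by rewrite ts andbT; apply/injectiveP.
  have := gP t tI.
  have : \sum_i m' i (r i) <= w t + k%:R * h.
    rewrite mulr_natl -[k in h *+ k]card_ord -sumr_const -big_split /=.
    apply: ler_sum => i _; rewrite ffunE lerD2l.
    by case: (_ != _); rewrite ?mulr1 ?mulr0 // ltW.
  rewrite -/(w s); lra.
rewrite {}rs {rinj eqr} in yoff yeq.
(* Off [s] the equilibrium leaves slack [h / 2]. Half of it moves from the row duals to the prices
   of assigned columns, making these positive; the other half remains as the strict gap. *)
exists s, (fun i => m i (s i) 0 - y (s i) - h / 4),
  (fun j => y j + (h / 4) * (j \in codom s)%:R), (h / 4); split.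
- by split => //; rewrite divr_gt0.
- by move=> i; rewrite codom_f mulr1; lra.
- move=> i j js; have := yeq i j; rewrite /m' js eqxx mulr0 mulr1 addr0.
  by have [jc|jc] := boolP (j \in codom s); rewrite ?mulr1 ?mulr0; lra.
- by move=> i; rewrite codom_f mulr1; have := y0 (s i); lra.
- by move=> j jc; rewrite yoff // (negPf jc) mulr0 addr0.
Qed.
End Assignment.

(** * The SDP near a commuting tuple *)

Section RankOne.
Context {R : realType}.

Lemma dot_trace n (u v : 'cV[R]_n) : \tr (u *m v^T) = dot v u.
Proof. by rewrite mxtrace_mulC /mxtrace big_ord1. Qed.

Lemma dot_rank1 n (v x y : 'cV[R]_n) :
  dot x (v *m v^T *m y) = dot x v * dot v y.
Proof.
rewrite -mulmxA [v^T *m y]mx11_scalar -/(dot v y) mul_mx_scalar dotZr.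
by rewrite mulrC.
Qed.

Lemma psd_dot n (A : 'M[R]_n) :
  psd A <-> symmetric_mx A /\ forall x, 0 <= dot x (A *m x).
Proof.
by split=> -[sA pA]; split => // x; have := pA x; rewrite /dot mulmxA.
Qed.

Lemma psd_rank1 n (v : 'cV[R]_n) : psd (v *m v^T).
Proof.
apply/psd_dot; split; first by rewrite /symmetric_mx trmx_mul trmxK.
by move=> x; rewrite dot_rank1 dotC -expr2 sqr_ge0.
Qed.

Lemma mxtrace_psd_ge0 n (A B : 'M[R]_n) : psd A -> psd B -> 0 <= \tr (A *m B).
Proof.
move=> /psd_dot[_ pA] /psd_factor[C ->].
rewrite mulmxA mxtrace_mulC mulmxA mxtrace_quad.
by apply: sumr_ge0 => i _; exact: pA.
Qed.

Lemma bessel k d (v : 'I_k -> 'cV[R]_d) x : orthonormal v ->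
  \sum_i dot (v i) x ^+ 2 <= dot x x.
Proof.
move=> ov; pose p := \sum_i dot (v i) x *: v i.
have vp i : dot (v i) p = dot (v i) x.
  rewrite dot_sumr (bigD1 i) //= dotZr ov eqxx mulr1 big1 ?addr0 // => j ji.
  by rewrite dotZr ov eq_sym (negPf ji) mulr0.
have xp : dot x p = \sum_i dot (v i) x ^+ 2.
  by rewrite dot_sumr; apply: eq_bigr => i _; rewrite dotZr dotC.
have pp : dot p p = \sum_i dot (v i) x ^+ 2.
  rewrite {2}/p dot_sumr; apply: eq_bigr => i _.
  by rewrite dotZr (dotC p) vp.
have := dot_ge0 (x - p); rewrite dotBl !dotBr (dotC p x) xp pp; lra.
Qed.

(** The constraint on the sum is Bessel's inequality. *)
Lemma orthonormal_feasible k d (v : 'I_k -> 'cV[R]_d) : orthonormal v ->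
  sdp_feasible (fun i => v i *m (v i)^T).
Proof.
move=> ov; split => [|i|i]; last exact: psd_rank1.
  apply/psd_dot; split.
    rewrite /symmetric_mx linearB /= trmx1 linear_sum /=; congr (_ - _).
    by apply: eq_bigr => i _; rewrite trmx_mul trmxK.
  move=> x; rewrite mulmxBl mul1mx dotBr mulmx_suml dot_sumr subr_ge0.
  apply: le_trans (bessel x ov); apply: ler_sum => i _.
  by rewrite dot_rank1 (dotC x) expr2.
by rewrite dot_trace ov eqxx.
Qed.

(** Since [Z] is symmetric and kills [v], only the component of [x] orthogonal to [v] contributes to
    the form. *)
Lemma quad_orth n (Z : 'M[R]_n) (v : 'cV[R]_n) g x :
  symmetric_mx Z -> dot v v = 1 -> Z *m v = 0 ->
  (forall w, dot v w = 0 -> g * dot w w <= dot w (Z *m w)) ->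
  g * dot (x - dot v x *: v) (x - dot v x *: v) <= dot x (Z *m x).
Proof.
move=> sZ vv Zv h; set w := x - _.
have vw : dot v w = 0 by rewrite dotBr dotZr vv mulr1 subrr.
have -> : x = w + dot v x *: v by rewrite subrK.
clearbody w; rewrite mulmxDr -scalemxAr Zv scaler0 addr0 dotDl dotZl.
by rewrite (dot_mulmxr Z v) sZ Zv dot0l mulr0 addr0 h.
Qed.

(* Complementary slackness: [Y] and [lam] are dual feasible, and the slack
   matrices [Y + lam i - c i] have kernel spanned by [v i]. *)
Lemma sdp_certificate k d (c : 'I_k -> 'M[R]_d) (v : 'I_k -> 'cV[R]_d)
    (lam : 'I_k -> R) (Y : 'M[R]_d) (g : R) :
  0 < g -> orthonormal v -> (forall i, symmetric_mx (c i)) -> psd Y ->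
  \tr Y = \sum_i dot (v i) (Y *m v i) ->
  (forall i, (Y + (lam i)%:M - c i) *m v i = 0) ->
  (forall i x, dot (v i) x = 0 ->
     g * dot x x <= dot x ((Y + (lam i)%:M - c i) *m x)) ->
  sdp_rank_one c.
Proof.
move=> g0 ov sc pY trY Zv Zpos X [[Xsum Xtr Xpsd] Xopt] i0.
pose Z i := Y + (lam i)%:M - c i.
have sZ i : symmetric_mx (Z i).
  by rewrite /symmetric_mx linearB linearD /= tr_scalar_mx sc pY.1.
have cE i : c i = Y + (lam i)%:M - Z i by rewrite opprB addrC subrK.
have objv : sdp_objective c (fun i => v i *m (v i)^T) = \tr Y + \sum_i lam i.
  rewrite /sdp_objective linear_sum trY -big_split /=; apply: eq_bigr => i _.
  rewrite mulmxA dot_trace cE mulmxBl Zv subr0 mulmxDl mul_scalar_mx.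
  by rewrite dotDr dotZr ov eqxx mulr1.
have objX : sdp_objective c X =
    \tr (Y *m \sum_i X i) + \sum_i lam i - \sum_i \tr (Z i *m X i).
  rewrite /sdp_objective mulmx_sumr !linear_sum /= -!big_split /=.
  apply: eq_bigr => i _; rewrite {1}cE mulmxBl mulmxDl mul_scalar_mx.
  by rewrite !linearD !linearN !linearZ /= Xtr mulr1.
have trYX : \tr (Y *m \sum_i X i) <= \tr Y.
  have := mxtrace_psd_ge0 pY Xsum.
  by rewrite mulmxBr mulmx1 linearB /= subr_ge0.
have /choice[B BX] : forall i, exists B : 'M[R]_d, X i = B *m B^T.
  by move=> i; exact: psd_factor.
pose P i : 'M[R]_d := 1%:M - v i *m (v i)^T.
(* The trace is the sum of the form of [Z i] over the columns of [B i], so it controls their squared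
   distances to the line of [v i]. *)
have trZX i : g * frobsq (P i *m B i) <= \tr (Z i *m X i).
  rewrite BX mulmxA mxtrace_mulC mulmxA mxtrace_quad frobsq_col big_distrr /=.
  apply: ler_sum => j _; rewrite frobsq_dot col_mulmx mulmxBl mul1mx.
  rewrite -mulmxA [_^T *m _]mx11_scalar -/(dot _ _) mul_mx_scalar.
  by apply: quad_orth (sZ i) _ (Zv i) (Zpos i); rewrite ov eqxx.
(* The frame attains the dual value [\tr Y + \sum_i lam i], so an optimal [X] has no room for
   positive slack. *)
have Zsum : \sum_i \tr (Z i *m X i) <= 0.
  have := Xopt _ (orthonormal_feasible ov); rewrite objv objX; lra.
have PB0 : P i0 *m B i0 = 0.
  apply: frobsq_eq0; apply/eqP; rewrite eq_le frobsq_ge0 andbT.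
  rewrite -(ler_pM2l g0) mulr0; apply: le_trans Zsum.
  apply: (le_trans (trZX i0)); rewrite (bigD1 i0) //= lerDl sumr_ge0 // => i _.
  by apply: le_trans (trZX i); rewrite mulr_ge0 ?frobsq_ge0 // ltW.
(* The columns of [B i0] lie on the line of [v i0], so the rank is at most one; trace one excludes
   zero. *)
have XE : X i0 = v i0 *m ((v i0)^T *m X i0).
  apply/eqP; rewrite -subr_eq0 mulmxA -{1}[X i0]mul1mx -mulmxBl.
  by rewrite BX mulmxA PB0 mul0mx.
apply/eqP; rewrite eqn_leq; apply/andP; split.
  by rewrite XE (leq_trans (mulmx_max_rank _ _)).
rewrite lt0n mxrank_eq0; apply/eqP => X0.
by have := Xtr i0; rewrite X0 mxtrace0 => /eqP; rewrite eq_sym oner_eq0.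
Qed.
End RankOne.

(** * Continuity of the dual matrices and the dual at a diagonal tuple *)

Section Local.
Context {R : realType}.

(** Each term is bounded by [|x_i x_j| <= (x_i^2 + x_j^2) / 2]; summing over both indices produces
    the factor [n]. *)
Lemma quad_perturb n (A B : 'M[R]_n) e x :
  (forall i j, `|A i j - B i j| <= e) ->
  dot x (B *m x) - e * n%:R * dot x x <= dot x (A *m x).
Proof.
move=> AB; rewrite lerBlDr -lerBlDl -dotBr -mulmxBl dotE.
have term i j : x i 0 * ((B - A) i j * x j 0) <=
    e / 2 * (x i 0 ^+ 2 + x j 0 ^+ 2).
  have := AB i j; rewrite !mxE ler_norml => /andP[l1 l2].
  have := sqr_ge0 (x i 0 - x j 0); have := sqr_ge0 (x i 0 + x j 0).
  nra.
have -> : e * n%:R * dot x x =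
    \sum_i \sum_j e / 2 * (x i 0 ^+ 2 + x j 0 ^+ 2).
  have xx : dot x x = \sum_i x i 0 ^+ 2 by rewrite dotE.
  under eq_bigr do rewrite -big_distrr big_split /= -xx sumr_const card_ord.
  rewrite -big_distrr big_split /= sumr_const card_ord sumrMnl -xx.
  by rewrite -mulr_natr; field.
apply: ler_sum => i _; rewrite mxE big_distrr; apply: ler_sum => j _.
exact: term.
Qed.

Definition frame_mx k d (v : 'I_k -> 'cV[R]_d) : 'M[R]_(d, k) :=
  \matrix_(a, i) v i a 0.

Lemma col_frame_mx k d (v : 'I_k -> 'cV[R]_d) i : col i (frame_mx v) = v i.
Proof. by apply/colP => a; rewrite !mxE. Qed.

Lemma frame_mx_gram k d (v : 'I_k -> 'cV[R]_d) : orthonormal v ->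
  (frame_mx v)^T *m frame_mx v = 1%:M.
Proof.
by move=> ov; apply/matrixP => i j; rewrite mulmx_dot !col_frame_mx ov mxE.
Qed.

Definition multiplier k d (lam : 'I_k -> R) (c : 'I_k -> 'M[R]_d)
    (v : 'I_k -> 'cV[R]_d) : 'M[R]_k :=
  \matrix_(i, j) dot (v i) (c i *m v j) - diag_mx (\row_i lam i).

(** The candidate multiplier of the constraint on the sum. It is built from the frame [v], so that
    complementary slackness can hold exactly and not just approximately. *)
Definition dual_mx k d (lam : 'I_k -> R) (c : 'I_k -> 'M[R]_d)
    (v : 'I_k -> 'cV[R]_d) : 'M[R]_d :=
  frame_mx v *m multiplier lam c v *m (frame_mx v)^T.

Section Entrywise.
Context {T : Type} {F : set_system T} {FF : Filter F}.

(** Entrywise convergence along any filter, so that it applies to pairs of a tuple and a frame. *)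
Definition ecvg m n (A : T -> 'M[R]_(m, n)) (B : 'M[R]_(m, n)) :=
  forall i j, A t i j @[t --> F] --> B i j.

Lemma ecvg_cst m n (A : 'M[R]_(m, n)) : ecvg (fun=> A) A.
Proof. by move=> i j; exact: cvg_cst. Qed.

Lemma ecvgD m n (A A' : T -> 'M[R]_(m, n)) B B' :
  ecvg A B -> ecvg A' B' -> ecvg (fun t => A t + A' t) (B + B').
Proof.
move=> AB AB' i j; rewrite mxE; under eq_fun do rewrite mxE.
exact: cvgD.
Qed.

Lemma ecvgB m n (A A' : T -> 'M[R]_(m, n)) B B' :
  ecvg A B -> ecvg A' B' -> ecvg (fun t => A t - A' t) (B - B').
Proof.
move=> AB AB' i j; rewrite !mxE; under eq_fun do rewrite !mxE.
exact: cvgB.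
Qed.

Lemma ecvg_tr m n (A : T -> 'M[R]_(m, n)) B :
  ecvg A B -> ecvg (fun t => (A t)^T) B^T.
Proof.
by move=> AB i j; rewrite mxE; under eq_fun do rewrite mxE; exact: AB.
Qed.

Lemma ecvgM m n p (A : T -> 'M[R]_(m, n)) (A' : T -> 'M[R]_(n, p)) B B' :
  ecvg A B -> ecvg A' B' -> ecvg (fun t => A t *m A' t) (B *m B').
Proof.
move=> AB AB' i j; rewrite mxE; under eq_fun do rewrite mxE.
by apply: cvg_bigsum => l; apply: cvgM.
Qed.

Lemma ecvg_near m n (A : T -> 'M[R]_(m, n)) B e : ecvg A B -> 0 < e ->
  \forall t \near F, forall i j, `|A t i j - B i j| < e.
Proof.
move=> AB e0; apply: filter_forall => i; apply: filter_forall => j.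
by have /cvgr_distC_lt := AB i j; exact.
Qed.

Lemma ecvg_multiplier k d lam (c : T -> 'I_k -> 'M[R]_d)
    (v : T -> 'I_k -> 'cV[R]_d) c0 v0 :
  (forall i, ecvg (fun t => c t i) (c0 i)) ->
  (forall i, ecvg (fun t => v t i) (v0 i)) ->
  ecvg (fun t => multiplier lam (c t) (v t)) (multiplier lam c0 v0).
Proof.
move=> cc vv; apply: ecvgB; last exact: ecvg_cst.
move=> i j; rewrite mxE; under eq_fun do rewrite mxE.
have := ecvgM (ecvg_tr (vv i)) (ecvgM (cc i) (vv j)).
exact.
Qed.

Lemma ecvg_dual_mx k d lam (c : T -> 'I_k -> 'M[R]_d)
    (v : T -> 'I_k -> 'cV[R]_d) c0 v0 :
  (forall i, ecvg (fun t => c t i) (c0 i)) ->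
  (forall i, ecvg (fun t => v t i) (v0 i)) ->
  ecvg (fun t => dual_mx lam (c t) (v t)) (dual_mx lam c0 v0).
Proof.
move=> cc vv.
have fv : ecvg (fun t => frame_mx (v t)) (frame_mx v0).
  by move=> a i; rewrite mxE; under eq_fun do rewrite mxE; exact: vv.
apply: ecvgM (ecvg_tr fv); apply: ecvgM fv _; exact: ecvg_multiplier.
Qed.
End Entrywise.

(** Joint continuity in the tuple and the frame, obtained from convergence along the filter
    generated by entrywise neighborhoods of [(c0, v0)]. *)
Lemma dual_mx_near k d lam (c0 : 'I_k -> 'M[R]_d) (v0 : 'I_k -> 'cV[R]_d) (e : R) :
  0 < e -> exists2 r : R, 0 < r &
    forall (c : 'I_k -> 'M[R]_d) (v : 'I_k -> 'cV[R]_d),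
    (forall i a b, `|c i a b - c0 i a b| < r) ->
    (forall i a, `|v i a 0 - v0 i a 0| < r) ->
    (forall i j, `|multiplier lam c v i j - multiplier lam c0 v0 i j| < e) /\
    forall i a b, `|(dual_mx lam c v + (lam i)%:M - c i) a b -
                    (dual_mx lam c0 v0 + (lam i)%:M - c0 i) a b| < e.
Proof.
move=> e0.
pose T := (('I_k -> 'M[R]_d) * ('I_k -> 'cV[R]_d))%type.
pose near (r : R) : set T := [set t : T | (forall i a b, `|t.1 i a b - c0 i a b| < r) /\
   (forall i a, `|t.2 i a 0 - v0 i a 0| < r)].
pose F : set_system T := filter_from [set r : R | 0 < r] near.
have FF : Filter F.
  apply: filter_from_filter; first by exists 1; exact: ltr01.
  move=> r s /= r0 s0; exists (Num.min r s) => [|t [ct vt]].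
    by rewrite /= lt_min r0.
  split; split => [i a b|i a].
  - by have := ct i a b; rewrite lt_min => /andP[].
  - by have := vt i a; rewrite lt_min => /andP[].
  - by have := ct i a b; rewrite lt_min => /andP[].
  - by have := vt i a; rewrite lt_min => /andP[].
have cc i : ecvg (F := F) (fun t => t.1 i) (c0 i).
  move=> a b; apply/cvgrPdistC_lt => r r0; exists r => // t [ct _].
  exact: ct.
have vv i : ecvg (F := F) (fun t => t.2 i) (v0 i).
  move=> a b; apply/cvgrPdistC_lt => r r0; exists r => // t [_ vt].
  by rewrite (ord1 b); exact: vt.
have h1 : \forall t \near F, forall i j,
    `|multiplier lam t.1 t.2 i j - multiplier lam c0 v0 i j| < e.
  exact: ecvg_near (ecvg_multiplier cc vv) e0.
have h2 : \forall t \near F, forall i a b,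
  `|(dual_mx lam t.1 t.2 + (lam i)%:M - t.1 i) a b -
    (dual_mx lam c0 v0 + (lam i)%:M - c0 i) a b| < e.
  apply: filter_forall => i; apply: ecvg_near e0.
  apply: ecvgB (cc i); apply: ecvgD; last exact: ecvg_cst.
  exact: ecvg_dual_mx.
have [r r0 rP] := filterI h1 h2.
by exists r => // c v cr vr; apply: (rP (c, v)).
Qed.

Section StrictDual.
Context {k d : nat} {m : 'I_k -> 'cV[R]_d} {s : 'I_k -> 'I_d}
  {lam : 'I_k -> R} {y : 'I_d -> R} {g : R}.
Hypotheses (sinj : injective s) (g0 : 0 < g)
  (eq_s : forall i, lam i + y (s i) = m i (s i) 0)
  (gap_s : forall i j, j != s i -> m i j 0 + g <= lam i + y j)
  (y_s : forall i, g <= y (s i)) (y_off : forall j, j \notin codom s -> y j = 0).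

Local Notation D i := (diag_mx (m i)^T).
Local Notation e_ i := (delta_mx (s i) 0 : 'cV[R]_d).

Lemma price_ge0 j : 0 <= y j.
Proof.
have [/codomP[i ->]|/y_off->//] := boolP (j \in codom s).
by rewrite (le_trans (ltW g0)).
Qed.

Lemma orthonormal_assign : orthonormal (fun i => e_ i).
Proof. by move=> i j; rewrite dot_delta mxE eqxx andbT (inj_eq sinj). Qed.

Lemma quad_diag i (x : 'cV[R]_d) :
  dot x (D i *m x) = \sum_a m i a 0 * x a 0 ^+ 2.
Proof.
by rewrite dotE; apply: eq_bigr => a _; rewrite mul_diag_mx !mxE mulrCA expr2.
Qed.

(** The squared coordinates of an orthonormal frame are LP feasible, the column bound being Bessel's
    inequality; by the dual gap, mass off [s] costs at least [g] per unit. *)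
Lemma diag_value_le (v : 'I_k -> 'cV[R]_d) : orthonormal v ->
  frame_value (fun i => D i) v + g * \sum_i (1 - v i (s i) 0 ^+ 2) <=
  \sum_i m i (s i) 0.
Proof.
move=> ov.
have vE i : \sum_a v i a 0 ^+ 2 = 1.
  have <- : dot (v i) (v i) = 1 by rewrite ov eqxx.
  by rewrite dotE.
have step i : dot (v i) (D i *m v i) + g * (1 - v i (s i) 0 ^+ 2) <=
    lam i + \sum_a y a * v i a 0 ^+ 2.
  have rest : 1 - v i (s i) 0 ^+ 2 = \sum_(a | a != s i) v i a 0 ^+ 2.
    by rewrite -(vE i) (bigD1 (s i)) //= addrAC subrr add0r.
  have key : \sum_(a | a != s i) m i a 0 * v i a 0 ^+ 2 +
      g * (1 - v i (s i) 0 ^+ 2) <= lam i * (1 - v i (s i) 0 ^+ 2) +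
      \sum_(a | a != s i) y a * v i a 0 ^+ 2.
    rewrite rest !big_distrr /= -!big_split /=; apply: ler_sum => a ai.
    by rewrite -!mulrDl ler_wpM2r ?sqr_ge0 // gap_s.
  rewrite quad_diag (bigD1 (s i)) //= [X in _ <= _ + X](bigD1 (s i)) //= -eq_s.
  nra.
have cols : \sum_i \sum_a y a * v i a 0 ^+ 2 <= \sum_i y (s i).
  rewrite -(sum_codom sinj y_off) exchange_big; apply: ler_sum => a _ /=.
  rewrite -big_distrr -[leRHS]mulr1 ler_wpM2l ?price_ge0 //=.
  have := bessel (delta_mx a 0 : 'cV[R]_d) ov; rewrite dot_delta mxE !eqxx.
  by apply: le_trans; apply: ler_sum => i _; rewrite (dotC (v i)) dot_delta.
rewrite big_distrr -big_split /=; apply: (le_trans (ler_sum _ (fun i _ => step i))).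
have -> : \sum_i m i (s i) 0 = \sum_i lam i + \sum_i y (s i).
  by rewrite -big_split; apply: eq_bigr => i _; rewrite /= eq_s.
by rewrite big_split lerD2l.
Qed.

(** Compares the maximiser with the frame of unit vectors. Passing between [c] and the diagonal
    tuple costs [k * r * d] on each side, and the gap turns the loss into a bound on the mass of
    [v i] off [s i]. *)
Lemma frame_max_near (c : 'I_k -> 'M[R]_d) v r i :
  (forall i a b, `|c i a b - D i a b| <= r) -> frame_max c v ->
  g * (1 - v i (s i) 0 ^+ 2) <= 2 * (k%:R * (r * d%:R)).
Proof.
move=> cD [ov vmax].
have valD : frame_value c v <= frame_value (fun i => D i) v + k%:R * (r * d%:R).
  rewrite mulr_natl -[k in _ *+ k]card_ord -sumr_const -big_split /=.
  apply: ler_sum => j _.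
  have Dc a b : `|D j a b - c j a b| <= r by rewrite distrC.
  by have := quad_perturb (v j) Dc; rewrite ov eqxx mulr1 lerBlDr.
have valE : \sum_i m i (s i) 0 <= frame_value c (fun i => e_ i) + k%:R * (r * d%:R).
  rewrite mulr_natl -[k in _ *+ k]card_ord -sumr_const -big_split /=.
  apply: ler_sum => j _.
  have := quad_perturb (e_ j) (cD j); rewrite quad_diag orthonormal_assign eqxx.
  rewrite mulr1 lerBlDr; apply: le_trans.
  rewrite (bigD1 (s j)) //= mxE !eqxx expr1n mulr1 big1 ?addr0 // => a ai.
  by rewrite mxE (negPf ai) expr0n mulr0.
have := diag_value_le ov; have := vmax _ orthonormal_assign.
have : g * (1 - v i (s i) 0 ^+ 2) <= g * \sum_i (1 - v i (s i) 0 ^+ 2).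
  rewrite ler_pM2l // (bigD1 i) //= lerDl sumr_ge0 // => j _.
  by rewrite subr_ge0 orthonormal_coord.
lra.
Qed.

Lemma multiplier_assign :
  multiplier lam (fun i => D i) (fun i => e_ i) = diag_mx (\row_i y (s i)).
Proof.
apply/matrixP => i j; rewrite !mxE dot_delta mul_diag_mx !mxE eqxx andbT.
rewrite (inj_eq sinj); have [->|ij] := eqVneq i j.
  by rewrite !mulr1n mulr1 -eq_s addrAC subrr add0r.
by rewrite !mulr0n mulr0 subrr.
Qed.

Lemma dual_mx_assign :
  dual_mx lam (fun i => D i) (fun i => e_ i) = diag_mx (\row_j y j).
Proof.
rewrite /dual_mx multiplier_assign mul_mx_diag; apply/matrixP => a b.
rewrite !mxE; have [/codomP[i ->]|aN] := boolP (a \in codom s).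
  rewrite (bigD1 i) //= !mxE !eqxx /= mul1r big1 ?addr0 => [|j ji].
    by rewrite andbT eq_sym mulr_natr.
  by rewrite !mxE (inj_eq sinj) eq_sym (negPf ji) !mul0r.
rewrite y_off // mul0rn big1 // => i _; rewrite !mxE.
have /negPf -> : a != s i by apply: contra aN => /eqP ->; exact: codom_f.
by rewrite !mul0r.
Qed.

(** The slack matrix is diagonal, with entry 0 at [s i] and entries at least [g] elsewhere. *)
Lemma slack_assign i (x : 'cV[R]_d) :
  g * (dot x x - x (s i) 0 ^+ 2) <=
  dot x ((diag_mx (\row_j y j) + (lam i)%:M - D i) *m x).
Proof.
rewrite mulmxBl mulmxDl mul_scalar_mx dotBr dotDr dotZr quad_diag !dotE.
under [X in _ <= X + _ - _]eq_bigr do rewrite mul_diag_mx !mxE mulrCA -expr2.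
rewrite (eq_bigr (fun a => x a 0 ^+ 2)) // (bigD1 (s i)) //=.
rewrite [X in X + _ - _](bigD1 (s i)) //= [X in _ - X](bigD1 (s i)) //=.
rewrite -eq_s addrAC subrr add0r.
rewrite [X in _ <= X](_ : _ = \sum_(a | a != s i)
    (y a + lam i - m i a 0) * x a 0 ^+ 2); last first.
  under [in RHS]eq_bigr do rewrite mulrBl mulrDl.
  rewrite sumrB big_split /= -big_distrr /=; ring.
rewrite big_distrr /=; apply: ler_sum => a ai.
by rewrite ler_wpM2r ?sqr_ge0 //; have := gap_s ai; lra.
Qed.
End StrictDual.
End Local.

(** * Rank one near a diagonal tuple *)

Section LocalDiag.
Context {R : realType}.

Lemma mulmx_frame k d (v : 'I_k -> 'cV[R]_d) (u : 'cV[R]_k) :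
  frame_mx v *m u = \sum_j u j 0 *: v j.
Proof.
apply/colP => a; rewrite mxE summxE; apply: eq_bigr => j _.
by rewrite !mxE mulrC.
Qed.

(** Symmetry is the first order condition of the frame. The multiplier is close to the diagonal
    matrix of the assigned prices, which are large enough to absorb the error. *)
Lemma dual_mx_psd k d lam (c : 'I_k -> 'M[R]_d) v (y : 'I_k -> R) e :
  (forall i, symmetric_mx (c i)) -> frame_max c v ->
  (forall i j, `|multiplier lam c v i j - diag_mx (\row_i y i) i j| <= e) ->
  (forall i, e * k%:R <= y i) -> psd (dual_mx lam c v).
Proof.
move=> sc vmax near ye; apply/psd_dot; split.
  rewrite /symmetric_mx /dual_mx !trmx_mul trmxK mulmxA; congr (_ *m _ *m _).
  rewrite linearB /= tr_diag_mx; congr (_ - _); apply/matrixP => i j.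
  by rewrite !mxE (frame_critical j i sc vmax) dot_mulmxr sc dotC.
move=> x; rewrite /dual_mx -!mulmxA dot_mulmxr; set u := _ *m x.
apply: le_trans (quad_perturb u near); rewrite subr_ge0 !dotE big_distrr.
apply: ler_sum => i _; rewrite mul_diag_mx !mxE mulrCA -expr2.
by rewrite ler_wpM2r ?sqr_ge0.
Qed.

Lemma dual_mx_trace k d lam (c : 'I_k -> 'M[R]_d) v : orthonormal v ->
  \tr (dual_mx lam c v) = \sum_i dot (v i) (dual_mx lam c v *m v i).
Proof.
move=> ov; have VV := frame_mx_gram ov.
have := mxtrace_quad (dual_mx lam c v) (frame_mx v).
under eq_bigr do rewrite col_frame_mx; move=> <-.
rewrite /dual_mx [LHS]mxtrace_mulC [in LHS]mulmxA VV mul1mx.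
by rewrite !mulmxA VV mul1mx -[in RHS]mulmxA VV mulmx1.
Qed.

(** By the first order conditions [c i *m v i] lies in the span of the frame, and its coefficients
    are the entries of column [i] of [L]. *)
Lemma dual_mx_kernel k d lam (c : 'I_k -> 'M[R]_d) v i :
  (forall i, symmetric_mx (c i)) -> frame_max c v ->
  (dual_mx lam c v + (lam i)%:M - c i) *m v i = 0.
Proof.
move=> sc vmax; have VV := frame_mx_gram vmax.1.
rewrite mulmxBl mulmxDl mul_scalar_mx; apply/eqP; rewrite subr_eq0; apply/eqP.
rewrite -{1}(col_frame_mx v i) -col_mulmx /dual_mx -mulmxA VV mulmx1 col_mulmx.
rewrite mulmx_frame (frame_critical_orth i sc vmax).
rewrite (bigD1 i) //= [RHS](bigD1 i) //= addrAC !mxE eqxx mulr1n -scalerDl subrK.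
congr (_ + _); apply: eq_bigr => j ji.
by rewrite !mxE (negPf ji) mulr0n subr0 (frame_critical j i sc vmax).
Qed.

Lemma frame_max_flip k d (c : 'I_k -> 'M[R]_d) v (z : 'I_k -> R) :
  (forall i, z i ^+ 2 = 1) -> frame_max c v ->
  frame_max c (fun i => z i *: v i).
Proof.
move=> z1 [ov vmax]; split=> [i j|u ou].
  rewrite dotZl dotZr ov; have [->|ij] := eqVneq i j; last by rewrite !mulr0.
  by rewrite mulr1 -expr2 z1.
apply: le_trans (vmax u ou) _; rewrite /frame_value le_eqVlt; apply/orP; left.
apply/eqP; apply: eq_bigr => i _.
by rewrite -scalemxAr dotZl dotZr mulrA -expr2 z1 mul1r.
Qed.

Lemma sdp_local_diag k d (m : 'I_k -> 'cV[R]_d) :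
  (k < d)%N -> lp_unique_optimum m ->
  exists2 r : R, 0 < r & forall c : 'I_k -> 'M[R]_d,
    (forall i, symmetric_mx (c i)) ->
    (forall i a b, `|c i a b - diag_mx (m i)^T a b| < r) -> sdp_rank_one c.
Proof.
move=> kd /(strict_dual kd)[s [lam [y [g [[sinj g0] eq_s gap_s y_s y_off]]]]].
pose D i := diag_mx (m i)^T; pose E i : 'cV[R]_d := delta_mx (s i) 0.
have d0 : 0 < d.+1%:R :> R by [].
(* Entrywise error [e] changes a quadratic form by at most [g / 4] times the squared length. *)
pose e := g / (4 * d.+1%:R).
have e0 : 0 < e by rewrite divr_gt0 // mulr_gt0.
have ed : 4 * (e * d%:R) <= g.
  have -> : g = 4 * (e * d.+1%:R).
    by rewrite mulrCA /e divfK // gt_eqF // mulr_gt0.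
  by rewrite !ler_pM2l // ler_nat.
have [r0 r00 r0P] := dual_mx_near lam D E e0.
(* Bound for the squared distance of [v i] to the unit vector [E i]: [r0 ^+ 2] serves the continuity
   lemma, [1/4] the slack estimate at the end. *)
pose t := Num.min (r0 ^+ 2) 4^-1.
have t0 : 0 < t by rewrite lt_min exprn_gt0 //= invr_gt0 ltr0n.
pose K : R := k%:R * d%:R.
have K0 : 0 <= K by rewrite mulr_ge0 ?ler0n.
(* The squared distance is [2 * (1 - v i (s i) 0)], hence at most [4 * K * r / g] once the signs are
   fixed. The [+ 1] keeps the denominator positive when [K = 0]. *)
pose r := Num.min r0 (t * g / (4 * K + 1)).
have K1 : 0 < 4 * K + 1 by rewrite ltr_wpDl ?mulr_ge0 ?ler0n ?ltr01.
have r_gt0 : 0 < r by rewrite lt_min r00 divr_gt0 // mulr_gt0.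
have rK : 4 * K * r < t * g.
  have : r <= t * g / (4 * K + 1) by rewrite ge_min lexx orbT.
  by rewrite ler_pdivlMr // => h; lra.
exists r => // c sc cD.
have cD0 i a b : `|c i a b - D i a b| < r0.
  by apply: lt_le_trans (cD i a b) _; rewrite ge_min lexx.
have [v1 v1max] := frame_max_exists c (orthonormal_assign (R := R) sinj).
(* A maximiser is determined only up to signs; they are chosen so that [v i] is close to [E i] and
   not to [- E i]. *)
pose v i := (if v1 i (s i) 0 < 0 then - 1 else 1) *: v1 i.
have vmax : frame_max c v.
  by apply: frame_max_flip v1max => i; case: ifP; rewrite ?sqrrN expr1n.
have ov := vmax.1.
have vs0 i : 0 <= v i (s i) 0.
  by rewrite mxE; case: ltP => h; rewrite ?mulN1r ?mul1r // oppr_ge0 ltW.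
clearbody v.
have EE i : E i (s i) 0 = 1 by rewrite mxE !eqxx.
have vE i : dot (v i - E i) (v i - E i) < t.
  have le_r i0 a b : `|c i0 a b - D i0 a b| <= r by rewrite ltW // cD.
  have h1 := frame_max_near sinj g0 eq_s gap_s y_s y_off i le_r vmax.
  have h2 := orthonormal_coord i (s i) ov.
  rewrite dotBl !dotBr ov eqxx (dotC (v i)) !dot_delta EE.
  have h3 := vs0 i.
  have h4 : v i (s i) 0 <= 1 by nra.
  have h5 : 1 - v i (s i) 0 <= 1 - v i (s i) 0 ^+ 2 by nra.
  have h6 : g * (1 - v i (s i) 0) <= g * (1 - v i (s i) 0 ^+ 2).
    by rewrite ler_pM2l.
  by rewrite -(ltr_pM2l g0) /=; rewrite /K in rK; lra.
have vE0 i a : `|v i a 0 - E i a 0| < r0.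
  have : (v i a 0 - E i a 0) ^+ 2 < r0 ^+ 2.
    apply: lt_le_trans (_ : t <= _); last by rewrite ge_min lexx.
    apply: le_lt_trans (vE i); rewrite dotE (bigD1 a) //= !mxE -expr2 lerDl.
    by rewrite sumr_ge0 // => j _; rewrite -expr2 sqr_ge0.
  by rewrite ltr_norml => h; apply/andP; split; nra.
have [Mnear Znear] := r0P c v cD0 vE0.
have kd' : k%:R <= d%:R :> R by rewrite ler_nat ltnW.
apply: (@sdp_certificate R k d c v lam (dual_mx lam c v) (g / 2)) => //.
- by rewrite divr_gt0.
- apply: (dual_mx_psd (y := fun i => y (s i)) (e := e) sc vmax) => [i j|i].
    by rewrite -(multiplier_assign sinj eq_s) ltW // Mnear.
  apply: le_trans (y_s i); nra.
- exact: dual_mx_trace.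
- by move=> i; exact: dual_mx_kernel.
move=> i x vx.
have Zle a b : `|(dual_mx lam c v + (lam i)%:M - c i) a b -
    (diag_mx (\row_j y j) + (lam i)%:M - D i) a b| <= e.
  by have := Znear i a b; rewrite (dual_mx_assign sinj eq_s y_off) => /ltW.
apply: le_trans (quad_perturb x Zle).
have := slack_assign eq_s gap_s i x.
(* As [x] is orthogonal to [v i], its coordinate at [s i] is an inner product with the short vector
   [E i - v i]. The slack is thus at least [3/4 * g - 1/4 * g = g / 2]. *)
have xs : x (s i) 0 ^+ 2 <= 4^-1 * dot x x.
  have -> : x (s i) 0 = dot (E i - v i) x by rewrite dotBl vx subr0 dot_delta.
  apply: le_trans (dot_cauchy _ _) _; rewrite ler_wpM2r ?dot_ge0 //.
  rewrite -opprB dotNl dotC dotNl opprK; apply: le_trans (ltW (vE i)) _.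
  by rewrite ge_min lexx orbT.
have := dot_ge0 x; nra.
Qed.
End LocalDiag.

(** * Change of basis and neighborhoods in the coefficient set *)

Section Neighbourhoods.
Context {R : realType}.

Lemma psd_conj d (Q A : 'M[R]_d) : psd A -> psd (Q^T *m A *m Q).
Proof.
move=> /psd_dot[sA pA]; apply/psd_dot; split.
  by rewrite /symmetric_mx !trmx_mul trmxK sA mulmxA.
by move=> x; rewrite -!mulmxA dot_mulmxr trmxK.
Qed.

Lemma sdp_feasible_conj k d (Q : 'M[R]_d) (X : 'I_k -> 'M[R]_d) :
  Q^T *m Q = 1%:M -> sdp_feasible X ->
  sdp_feasible (fun i => Q^T *m X i *m Q).
Proof.
move=> QQ [Xsum Xtr Xpsd]; split => [|i|i]; last exact: psd_conj.
  have E1 : 1%:M = Q^T *m 1%:M *m Q by rewrite mulmx1 QQ.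
  rewrite -mulmx_suml -mulmx_sumr /loewner_le [X in X - _]E1.
  by rewrite -mulmxBl -mulmxBr; exact: psd_conj.
by rewrite mxtrace_mulC mulmxA orthoC // mul1mx.
Qed.

Lemma sdp_objective_conj k d (Q : 'M[R]_d) (c X : 'I_k -> 'M[R]_d) :
  Q^T *m Q = 1%:M ->
  sdp_objective (fun i => Q^T *m c i *m Q) (fun i => Q^T *m X i *m Q) =
  sdp_objective c X.
Proof.
move=> QQ; rewrite /sdp_objective !linear_sum; apply: eq_bigr => i _.
rewrite /= !mulmxA -(mulmxA _ Q) orthoC // mulmx1 mxtrace_mulC !mulmxA.
by rewrite orthoC // mul1mx.
Qed.

(** Orthogonal conjugation permutes the feasible points and preserves objective and rank. *)
Lemma sdp_rank_one_conj k d (Q : 'M[R]_d) (c : 'I_k -> 'M[R]_d) :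
  Q^T *m Q = 1%:M -> sdp_rank_one (fun i => Q^T *m c i *m Q) ->
  sdp_rank_one c.
Proof.
move=> QQ c1 X [XF Xopt] i.
have QQ' : Q^T^T *m Q^T = 1%:M by rewrite trmxK orthoC.
have X'opt : sdp_optimal (fun i => Q^T *m c i *m Q) (fun i => Q^T *m X i *m Q).
  split; first exact: sdp_feasible_conj.
  move=> Y YF; have YF' := sdp_feasible_conj QQ' YF.
  have YE : Y = fun i => Q^T *m (Q^T^T *m Y i *m Q^T) *m Q.
    apply/funext => j; rewrite trmxK !mulmxA QQ mul1mx -mulmxA QQ.
    by rewrite mulmx1.
  by rewrite {1}YE !sdp_objective_conj //; exact: Xopt.
have Qu : Q \in unitmx by case: (mulmx1_unit QQ).
rewrite -(c1 _ X'opt i) mxrankMfree ?row_free_unit //.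
by rewrite eqmxMfull ?row_full_unit // unitmx_tr.
Qed.

Lemma orthonormal_entry d (Q : 'M[R]_d) i j : Q^T *m Q = 1%:M -> `|Q i j| <= 1.
Proof.
move=> QQ; have : (Q^T *m Q) j j = 1 by rewrite QQ mxE eqxx.
rewrite mulmx_dot dotE (bigD1 i) //= !mxE -expr2 => h.
have s0 : 0 <= \sum_(l | l != i) col j Q l 0 * col j Q l 0.
  by apply: sumr_ge0 => l _; rewrite -expr2 sqr_ge0.
by rewrite ler_norml; apply/andP; split; nra.
Qed.

Lemma conj_entry d (Q A : 'M[R]_d) r i j : Q^T *m Q = 1%:M ->
  (forall a b, `|A a b| <= r) -> `|(Q^T *m A *m Q) i j| <= d%:R ^+ 2 * r.
Proof.
move=> QQ Ar; rewrite mxE; apply: (le_trans (ler_norm_sum _ _ _)).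
have -> : d%:R ^+ 2 * r = \sum_(l < d) d%:R * r.
  by rewrite sumr_const card_ord -[RHS]mulr_natl mulrA expr2.
apply: ler_sum => l _; rewrite normrM mulrC -[leRHS]mul1r.
apply: ler_pM => //; first exact: orthonormal_entry.
rewrite mxE; apply: (le_trans (ler_norm_sum _ _ _)).
have -> : d%:R * r = \sum_(l < d) r by rewrite sumr_const card_ord mulr_natl.
apply: ler_sum => l' _; rewrite normrM -[leRHS]mul1r.
by apply: ler_pM => //; rewrite mxE; exact: orthonormal_entry.
Qed.

Lemma sdp_local k d (Q : 'M[R]_d) (c : 'I_k -> 'M[R]_d) (m : 'I_k -> 'cV[R]_d) :
  (k < d)%N -> diagonalizes Q c m -> lp_unique_optimum m ->
  exists2 r : R, 0 < r & forall c' : 'I_k -> 'M[R]_d,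
    (forall i, symmetric_mx (c' i)) ->
    (forall i a b, `|c' i a b - c i a b| < r) -> sdp_rank_one c'.
Proof.
move=> kd [QQ Qc] /(sdp_local_diag kd)[r r0 rP].
have d0 : 0 < d%:R ^+ 2 :> R by rewrite exprn_gt0 // ltr0n (leq_trans _ kd).
(* Conjugation enlarges an entrywise bound by at most [d ^ 2]; halving [r] makes the inequality
   strict. *)
exists (r / 2 / d%:R ^+ 2) => [|c' sc' c'c]; first by rewrite !divr_gt0.
apply: (sdp_rank_one_conj QQ); apply: rP => [i|i a b].
  by rewrite /symmetric_mx !trmx_mul trmxK sc' mulmxA.
have near a' b' : `|(c' i - c i) a' b'| <= r / 2 / d%:R ^+ 2.
  by rewrite !mxE ltW.
have -> : (Q^T *m c' i *m Q) a b - diag_mx (m i)^T a b =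
    (Q^T *m (c' i - c i) *m Q) a b.
  by rewrite mulmxBr mulmxBl Qc [RHS]mxE; congr (_ + _); rewrite [RHS]mxE.
have := conj_entry a b QQ near; rewrite mulrCA divff ?gt_eqF // mulr1 => h.
by apply: le_lt_trans h _; lra.
Qed.

(** Typed as a set in the product topology; matrix balls are entrywise, so this is a box around
    [c]. *)
Definition entry_ball k d (c : 'I_k -> 'M[R]_d) (r : R) :
    set {ptws 'I_k -> 'M[R]_d} :=
  [set c' : 'I_k -> 'M[R]_d | forall i, ball (c i) r (c' i)].

Lemma entry_ballP k d (c : 'I_k -> 'M[R]_d) r (c' : 'I_k -> 'M[R]_d) : 0 < r ->
  entry_ball c r c' <-> forall i a b, `|c' i a b - c i a b| < r.
Proof.
move=> r0; split=> [cc i a b|cc i]; first by rewrite distrC; have [_] := cc i; exact.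
by split => // a b; rewrite /ball /= distrC; exact: cc.
Qed.

Lemma entry_ball_open k d (c : 'I_k -> 'M[R]_d) r : open (entry_ball c r).
Proof.
rewrite openE => c' c'P.
apply: (@filter_forall _ _ _ _ (nbhs_filter (c' : {ptws 'I_k -> 'M[R]_d}))) => i.
apply: (@proj_continuous 'I_k (fun=> 'M[R]_d) i c' (ball (c i) r)).
by apply: open_nbhs_nbhs; split; [exact: ball_open | exact: c'P].
Qed.

Lemma coeffs_quad (mu : R) k d (c : 'I_k -> 'M[R]_d) : coeffs mu c <->
  forall i, [/\ symmetric_mx (c i), forall x, 0 <= dot x (c i *m x)
    & forall x, dot x (c i *m x) <= mu * dot x x].
Proof.
split=> cP i.
  have [sc /psd_dot[_]] := cP i; rewrite subr0 => p0 /psd_dot[_ p1].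
  split => // x; have := p1 x.
  by rewrite mulmxBl mul_scalar_mx dotBr dotZr subr_ge0.
have [sc p0 p1] := cP i; split => //; apply/psd_dot; rewrite ?subr0; split => //.
  by rewrite /symmetric_mx linearB /= tr_scalar_mx sc.
by move=> x; rewrite mulmxBl mul_scalar_mx dotBr dotZr subr_ge0.
Qed.

(* Moving towards mu/2 * I reaches the interior of the coefficient set. *)
Lemma full_dim_entry_ball (mu : R) k d (c : 'I_k -> 'M[R]_d) r :
  (0 < d)%N -> 0 < mu -> 0 < r -> coeffs mu c ->
  full_dim_nbhd mu c (coeffs mu `&` entry_ball c r).
Proof.
move=> d0 mu0 r0 cC; split; first by move=> ? [].
- by split => // i; exact: ballxx.
- by exists (entry_ball c r) => //; exact: entry_ball_open.
pose h i : 'M[R]_d := (mu / 2)%:M - c i.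
pose M := 1 + \sum_i \sum_a \sum_b `|h i a b|.
have hM i a b : `|h i a b| <= M.
  rewrite /M (bigD1 i) //= (bigD1 a) //= (bigD1 b) //= !addrA.
  rewrite -!addrA addrCA lerDl !addr_ge0 // !sumr_ge0 // => *.
    by rewrite sumr_ge0.
  by rewrite sumr_ge0 // => *; rewrite sumr_ge0.
have M0 : 0 < M.
  by rewrite ltr_pwDl // sumr_ge0 // => *; rewrite sumr_ge0 // => *; rewrite sumr_ge0.
(* The shift [t *: h] moves entries by at most [r / 2], and the forms at the shifted point lie
   between [t * mu / 2] and [mu - t * mu / 2] on unit vectors. *)
pose t := Num.min 1 (r / 2 / M).
have t0 : 0 < t by rewrite lt_min ltr01 !divr_gt0.
have t1 : t <= 1 by rewrite ge_min lexx.
have tM : t * M <= r / 2 by rewrite -ler_pdivlMr // ge_min lexx orbT.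
pose p i := c i + t *: h i.
(* Perturbing entries by [rho] changes the forms by at most [t * mu / 2], so both bounds of the
   coefficient set survive. *)
pose rho := Num.min (r / 2) (t * mu / 2 / d%:R).
have dR : 0 < d%:R :> R by rewrite ltr0n.
have rho0 : 0 < rho by rewrite lt_min !divr_gt0 // mulr_gt0.
have rhor : rho <= r / 2 by rewrite ge_min lexx.
have rhod : rho * d%:R <= t * mu / 2 by rewrite -ler_pdivlMr // ge_min lexx orbT.
have /coeffs_quad cP := cC.
exists (entry_ball p rho); split; first exact: entry_ball_open.
  exists p; split; last by move=> i; exact: ballxx.
  move=> i; have [sc _ _] := cP i.
  by rewrite /symmetric_mx linearD linearZ linearB /= tr_scalar_mx sc.
move=> c' [sc' /(entry_ballP _ _ rho0) c'p]; split; last first.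
  apply/(entry_ballP _ _ r0) => i a b.
  have := c'p i a b; have : `|t * h i a b| <= t * M.
    by rewrite normrM (ger0_norm (ltW t0)) ler_pM2l.
  rewrite [p i a b]mxE [(t *: h i) a b]mxE => h1 h2.
  have -> : c' i a b - c i a b = (c' i a b - (c i a b + t * h i a b)) + t * h i a b.
    by ring.
  by apply: le_lt_trans (ler_normD _ _) _; lra.
apply/coeffs_quad => i; have [sc p0 p1] := cP i.
have pE x : dot x (p i *m x) = (1 - t) * dot x (c i *m x) + t * mu / 2 * dot x x.
  rewrite mulmxDl -scalemxAl mulmxBl mul_scalar_mx dotDr dotZr dotBr dotZr.
  by field.
split; first exact: sc'.
  move=> x; have le1 a b : `|c' i a b - p i a b| <= rho by rewrite ltW.
  apply: le_trans (quad_perturb x le1); rewrite pE.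
  have := p0 x; have := dot_ge0 x; nra.
move=> x; have le1 a b : `|p i a b - c' i a b| <= rho by rewrite distrC ltW.
have := quad_perturb x le1; rewrite pE.
have := p1 x; have := p0 x; have := dot_ge0 x; nra.
Qed.
End Neighbourhoods.

(** * Almost commuting matrices *)

Section Pinching.
Context {R : realType}.

Definition commutator n (A B : 'M[R]_n) := A *m B - B *m A.

Definition pinch (K : eqType) n (f : 'I_n -> K) (A : 'M[R]_n) : 'M[R]_n :=
  \matrix_(a, b) if f a == f b then A a b else 0.

Section Cells.
Context {K : eqType} {n : nat} (f : 'I_n -> K).

Lemma pinch_sym A : symmetric_mx A -> symmetric_mx (pinch f A).
Proof.
move=> sA; apply/matrixP => a b; rewrite !mxE eq_sym.
by rewrite -{1}sA mxE.
Qed.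

Lemma sum_cells (F : 'I_n -> K -> R) :
  \sum_a F a (f a) =
  \sum_(c <- undup (codom f)) \sum_a (if f a == c then F a c else 0).
Proof.
rewrite exchange_big; apply: eq_bigr => a _.
rewrite (bigD1_seq (f a)) /= ?undup_uniq ?mem_undup ?codom_f // eqxx.
by rewrite big1 ?addr0 // => c; rewrite eq_sym => /negPf ->.
Qed.

(** On each cell the pinched matrix acts as [A] applied to the restriction of [x] to that cell, and
    the squared lengths of the restrictions add up to that of [x]. *)
Lemma pinch_contraction A : contraction A -> contraction (pinch f A).
Proof.
move=> cA x.
pose xc c : 'cV[R]_n := \col_b if f b == c then x b 0 else 0.
have frobsqE1 (z : 'cV[R]_n) : frobsq z = \sum_a z a 0 ^+ 2.
  by apply: eq_bigr => a _; rewrite big_ord1.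
have pE a : (pinch f A *m x) a 0 = (A *m xc (f a)) a 0.
  rewrite !mxE; apply: eq_bigr => b _; rewrite !mxE eq_sym.
  by case: ifP; rewrite ?mul0r ?mulr0.
rewrite frobsqE1; under eq_bigr do rewrite pE.
rewrite (sum_cells (fun a c => (A *m xc c) a 0 ^+ 2)).
have -> : frobsq x = \sum_(c <- undup (codom f)) frobsq (xc c).
  rewrite frobsqE1 (sum_cells (fun a _ => x a 0 ^+ 2)); apply: eq_bigr => c _.
  rewrite frobsqE1; apply: eq_bigr => a _; rewrite mxE.
  by case: ifP; rewrite // expr0n.
apply: ler_sum => c _; apply: le_trans (cA (xc c)); rewrite frobsqE1.
by apply: ler_sum => a _; case: ifP => // _; exact: sqr_ge0.
Qed.

(** Multiplication by a block diagonal matrix, from either side, commutes with pinching. *)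
Lemma pinch_comm A B :
  pinch f A = A -> comm_mx A B -> comm_mx (pinch f A) (pinch f B).
Proof.
move=> pA AB.
have l a b : (A *m pinch f B) a b = pinch f (A *m B) a b.
  rewrite !mxE; case: ifP => ab; last first.
    rewrite big1 // => c _; rewrite -pA !mxE.
    by case: (f a =P f c) => [e|_]; rewrite ?mul0r // -e ab mulr0.
  apply: eq_bigr => c _; rewrite -pA !mxE -(eqP ab) (eq_sym (f c)).
  by case: ifP; rewrite ?mul0r.
have r a b : (pinch f B *m A) a b = pinch f (B *m A) a b.
  rewrite !mxE; case: ifP => ab; last first.
    rewrite big1 // => c _; rewrite -pA !mxE.
    by case: (f a =P f c) => [e|_]; rewrite ?mul0r // -e ab mulr0.
  apply: eq_bigr => c _; rewrite -pA !mxE (eqP ab) (eq_sym (f c)).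
  by case: ifP; rewrite ?mulr0.
by rewrite pA /comm_mx; apply/matrixP => a b; rewrite l r AB.
Qed.

Lemma pinch_diag_comm (l : 'rV[R]_n) B :
  (forall a b, f a = f b -> l 0 a = l 0 b) -> comm_mx (diag_mx l) (pinch f B).
Proof.
move=> fl; rewrite /comm_mx mul_diag_mx mul_mx_diag; apply/matrixP => a b.
rewrite !mxE; case: eqP => [/fl ->|]; first by rewrite mulrC.
by rewrite mulr0 mul0r.
Qed.

Lemma pinch_offdiag A : frobsq (A - pinch f A) =
  \sum_a \sum_b (f a != f b)%:R * A a b ^+ 2.
Proof.
apply: eq_bigr => a _; apply: eq_bigr => b _; rewrite !mxE.
by case: eqP; rewrite ?subrr ?subr0 ?mul1r ?mul0r ?expr0n.
Qed.
End Cells.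

(** The random shift of the grid is discrete: one of the [N] integer offsets of a grid of step [N],
    so that averages are finite sums. *)
Definition shifted_cell N n (p : 'I_n -> int) (s : 'I_N) (a : 'I_n) : int :=
  ((p a + s%:Z) %/ N%:Z)%Z.

(** Increasing the point by one crosses a grid line for exactly one shift; for a unit step the sum
    telescopes to 1. *)
Lemma sum_shifted_div N (p : int) (n : nat) : (0 < N)%N ->
  \sum_(s < N) (((p + n%:Z + s%:Z) %/ N%:Z)%Z - ((p + s%:Z) %/ N%:Z)%Z) = n%:Z.
Proof.
move=> N0; elim: n => [|n IHn].
  by rewrite big1 // => s _; rewrite addr0 subrr.
pose u (s : nat) := ((p + n%:Z + s%:Z) %/ N%:Z)%Z.
have tele : \sum_(s < N) (u s.+1 - u s) = 1.
  rewrite -(big_mkord xpredT (fun s => u s.+1 - u s)) telescope_sumr //.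
  have -> : u N = 1 + u 0%N; last by rewrite addrK.
  rewrite /u addr0 (addrC (p + n%:Z)) -{1}[N%:Z]mul1r divzMDl //.
  by rewrite eqz_nat -lt0n.
rewrite -[RHS](_ : 1 + n%:Z = _) // -[X in 1 + X]IHn -tele -big_split.
apply: eq_bigr => s _; rewrite /u /= -[n.+1]addn1 -[s.+1]addn1 !PoszD.
have -> : p + n%:Z + (s%:Z + 1%:Z) = p + (n%:Z + 1%:Z) + s%:Z by ring.
by rewrite [RHS]addrA subrK.
Qed.

(** A shift that separates [a] and [b] makes their cell indices differ by at least 1, and these
    differences sum to the distance. *)
Lemma count_separated N n (p : 'I_n -> int) a b : (0 < N)%N ->
  \sum_(s < N) (shifted_cell p s a != shifted_cell p s b)%:R <=
  `|(p a)%:~R - (p b)%:~R| :> R.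
Proof.
move=> N0; wlog pab : a b / p a <= p b => [h|].
  have [/h //|/ltW/h] := leP (p a) (p b).
  by rewrite distrC; under eq_bigr do rewrite eq_sym.
have [q pq] : exists q : nat, p b = p a + q%:Z.
  exists `|p b - p a|%N; rewrite gez0_abs ?subr_ge0 //; ring.
have -> : `|(p a)%:~R - (p b)%:~R| = q%:~R :> R.
  by rewrite pq rmorphD /= opprD addrA subrr sub0r normrN ger0_norm.
rewrite -(sum_shifted_div (p a) q N0) rmorph_sum /=; apply: ler_sum => s _.
rewrite /shifted_cell pq; case: eqP => [->|ne] /=.
  by rewrite subrr.
rewrite -[1]/(1%:~R) ler_int -gtz0_ge1 subr_gt0 lt_neqAle; apply/andP; split.
  exact/eqP.
by rewrite lez_divRL // (le_trans (lez_floor _ _)) ?lerD2r ?lerDl // gt_eqF.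
Qed.

Lemma averaging N (F : 'I_N -> R) : (0 < N)%N ->
  exists s, F s * N%:R <= \sum_s F s.
Proof.
move=> N0; apply: contrapT => h.
have lt s : \sum_s F s < F s * N%:R.
  by rewrite ltNge; apply/negP => le; apply: h; exists s.
have : \sum_(s < N) \sum_s F s < \sum_(s < N) F s * N%:R.
  apply: ltr_sum; last by move=> s _; exact: lt.
  by apply/hasP; exists (Ordinal N0); rewrite ?mem_index_enum.
by rewrite sumr_const card_ord -big_distrl /= mulr_natr ltxx.
Qed.

(** Rounding gives [|p a - p b| <= 2 + u^2] with [u = (l a - l b) / th], and [th * u] times the
    entry of [B j] is the entry of the commutator. Some shift does at least as well as the
    average. *)
Lemma pinch_average N n k (th : R) (l : 'rV[R]_n) (B : 'I_k -> 'M[R]_n) :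
  (0 < N)%N -> 0 < th ->
  exists s : 'I_N, let f := shifted_cell (fun a => Num.floor (l 0 a / th)) s in
    (\sum_j frobsq (B j - pinch f (B j))) * N%:R <=
    \sum_j (2 * frobsq (B j) + frobsq (commutator (diag_mx l) (B j)) / th ^+ 2).
Proof.
move=> N0 th0; pose p a := Num.floor (l 0 a / th).
pose F (s : 'I_N) := \sum_j frobsq (B j - pinch (shifted_cell p s) (B j)).
have [s sP] := averaging F N0; exists s; apply: (le_trans sP).
rewrite /F exchange_big; apply: ler_sum => j _ /=.
under eq_bigr do rewrite pinch_offdiag.
have -> : 2 * frobsq (B j) + frobsq (commutator (diag_mx l) (B j)) / th ^+ 2 =
    \sum_a \sum_b (2 * B j a b ^+ 2 +
      commutator (diag_mx l) (B j) a b ^+ 2 / th ^+ 2).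
  rewrite /frobsq big_distrr [X in _ + X]big_distrl -big_split.
  apply: eq_bigr => a _; rewrite big_split /=.
  by rewrite [X in X + _]big_distrr [X in _ + X]big_distrl.
rewrite exchange_big; apply: ler_sum => a _.
rewrite exchange_big; apply: ler_sum => b _ /=.
rewrite /commutator -big_distrl /= mul_diag_mx mul_mx_diag !mxE.
apply: (@le_trans _ _ (`|(p a)%:~R - (p b)%:~R| * B j a b ^+ 2)).
  by rewrite ler_wpM2r ?sqr_ge0 // count_separated.
have -> : 2 * B j a b ^+ 2 + (l 0 a * B j a b - B j a b * l 0 b) ^+ 2 / th ^+ 2 =
    (2 + (l 0 a / th - l 0 b / th) ^+ 2) * B j a b ^+ 2.
  by field; rewrite gt_eqF.
rewrite ler_wpM2r ?sqr_ge0 // /p.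
set u := l 0 a / th; set w := l 0 b / th.
have := floor_itv u; have := floor_itv w; rewrite !rmorphD /=.
move=> /andP[w1 w2] /andP[u1 u2].
have := sqr_ge0 (u - w - 1); have := sqr_ge0 (u - w + 1) => h1 h2.
by rewrite ler_norml; apply/andP; split; nra.
Qed.
End Pinching.

(** * Making the matrices commute one after another *)

Section AlmostCommuting.
Context {R : realType}.

(** State after [r] steps. Contractivity is kept only for the matrices still to be treated, since
    rounding a spectrum to grid points can push it beyond 1. *)
Definition almost_commuting k n (r : nat) (eps : R) (c : 'I_k -> 'M[R]_n) :=
  [/\ forall i, symmetric_mx (c i),
      forall i j : 'I_k, (i < r)%N -> comm_mx (c i) (c j),
      forall j : 'I_k, (r <= j)%N -> contraction (c j)
    & forall i j, frobsq (commutator (c i) (c j)) <= eps * n%:R].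

Lemma comm_mx_commutator n (A B : 'M[R]_n) : comm_mx A B -> commutator A B = 0.
Proof. by move=> AB; apply/eqP; rewrite subr_eq0; apply/eqP. Qed.

Lemma commutatorN n (A B : 'M[R]_n) : commutator B A = - commutator A B.
Proof. by rewrite opprB. Qed.

Lemma commutator_conj n (Q A B : 'M[R]_n) : Q^T *m Q = 1%:M ->
  commutator (Q *m A *m Q^T) (Q *m B *m Q^T) = Q *m commutator A B *m Q^T.
Proof.
move=> QQ; rewrite /commutator mulmxBr mulmxBl !mulmxA.
by rewrite -!(mulmxA _ Q^T Q) QQ !mulmx1.
Qed.

Lemma comm_mx_conj n (Q A B : 'M[R]_n) : Q^T *m Q = 1%:M ->
  comm_mx A B -> comm_mx (Q *m A *m Q^T) (Q *m B *m Q^T).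
Proof.
move=> QQ AB; apply/eqP; rewrite -subr_eq0 -/(commutator _ _).
by rewrite commutator_conj // comm_mx_commutator // mulmx0 mul0mx.
Qed.

Lemma almost_commuting_conj k n r eps (Q : 'M[R]_n) (c : 'I_k -> 'M[R]_n) :
  Q^T *m Q = 1%:M -> almost_commuting r eps c ->
  almost_commuting r eps (fun i => Q *m c i *m Q^T).
Proof.
move=> QQ [sc cc kc ec]; split => [i|i j ir|j rj|i j].
- by rewrite /symmetric_mx !trmx_mul trmxK sc mulmxA.
- by apply: comm_mx_conj => //; exact: cc.
- by apply: contraction_conj => //; exact: kc.
- by rewrite commutator_conj // frobsq_conj.
Qed.

(** The difference of the commutators is a sum of four products of a small matrix with a
    contraction; four uses of the factor 2 bound give 46. *)
Lemma commutator_perturb n (A A' B B' : 'M[R]_n) e :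
  symmetric_mx A' -> symmetric_mx B -> contraction A' -> contraction B ->
  frobsq (commutator A B) <= e -> frobsq (A - A') <= e ->
  frobsq (B - B') <= e -> frobsq (commutator A' B') <= 50 * e.
Proof.
move=> sA' sB cA' cB h0 hA hB.
have -> : commutator A' B' = commutator A B - (A - A') *m B + B *m (A - A')
    - A' *m (B - B') + (B - B') *m A'.
  rewrite /commutator !mulmxBl !mulmxBr; apply/matrixP => i j; rewrite !mxE; ring.
have := contraction_mull (A - A') cB; have := contraction_mulr (A - A') sB cB.
have := contraction_mull (B - B') cA'; have := contraction_mulr (B - B') sA' cA'.
set P1 := frobsq (_ *m A'); set P2 := frobsq (A' *m _).
set P3 := frobsq (_ *m B); set P4 := frobsq (B *m _) => h1 h2 h3 h4.
have e0 : 0 <= e := le_trans (frobsq_ge0 _) h0.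
have := frobsqB (commutator A B) ((A - A') *m B).
have := frobsqD (commutator A B - (A - A') *m B) (B *m (A - A')).
have := frobsqB (commutator A B - (A - A') *m B + B *m (A - A')) (A' *m (B - B')).
have := frobsqD (commutator A B - (A - A') *m B + B *m (A - A') - A' *m (B - B'))
  ((B - B') *m A').
rewrite -/P1 -/P2 -/P3 -/P4; lra.
Qed.

Lemma commuting_step_diag k (r : 'I_k) (eta : R) : 0 < eta ->
  exists2 eps : R, 0 < eps & forall n (c : 'I_k -> 'M[R]_n) (l : 'rV[R]_n),
    almost_commuting r eps c -> c r = diag_mx l ->
    exists2 c', almost_commuting r.+1 eta c' &
      forall i, frobsq (c i - c' i) <= eta * n%:R.
Proof.
move=> eta0; pose tau := eta / 100.
have tau0 : 0 < tau by rewrite divr_gt0.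
pose N := (Num.bound (3 * k%:R / tau)).+1.
have N0 : (0 < N)%N by [].
have NR : 0 < N%:R :> R by rewrite ltr0n.
have kN : 3 * k%:R <= tau * N%:R.
  rewrite (mulrC tau) -ler_pdivrMr // ltW //.
  apply: (@lt_trans _ _ (Num.bound (3 * k%:R / tau))%:R); last by rewrite ltr_nat.
  by rewrite archi_boundP // divr_ge0 ?mulr_ge0 // ltW.
(* A cell then has length [th * N = min 1 eta], whose square is at most [eta]: the cost of making
   [c r] constant on cells. *)
pose th := Num.min 1 eta / N%:R.
have m0 : 0 < Num.min 1 eta by rewrite lt_min ltr01.
have th0 : 0 < th by rewrite divr_gt0.
have thN : (th * N%:R) ^+ 2 <= eta.
  rewrite /th divfK ?gt_eqF //.
  have : Num.min 1 eta <= 1 by rewrite ge_min lexx.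
  have : Num.min 1 eta <= eta by rewrite ge_min lexx orbT.
  nra.
(* The bound [th ^+ 2] keeps the commutator term of the average below [n], and [tau] feeds the
   perturbation estimate. *)
exists (Num.min (th ^+ 2) tau); first by rewrite lt_min exprn_gt0.
move=> n c l [sc cc kc ec] cr; set eps := Num.min _ _ in ec.
have n0 : 0 <= n%:R :> R by [].
have epsth : eps <= th ^+ 2 by rewrite ge_min lexx.
have epstau : eps <= tau by rewrite ge_min lexx orbT.
pose B (j : 'I_k) := if (r < j)%N then c j else 0.
have [s] := pinch_average l B N0 th0.
set p := (fun a => Num.floor (l 0 a / th)); set f := shifted_cell p s => /= avg.
have bound j : 2 * frobsq (B j) + frobsq (commutator (diag_mx l) (B j)) / th ^+ 2
    <= 3 * n%:R.
  rewrite /B; case: ifP => rj; last first.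
    rewrite /commutator mulmx0 mul0mx subrr.
    by rewrite frobsq0 mulr0 mul0r addr0 mulr_ge0.
  have := contraction_frobsq (kc j (ltnW rj)).
  have := ec r j; rewrite cr => h1 h2.
  have : frobsq (commutator (diag_mx l) (c j)) / th ^+ 2 <= n%:R.
    rewrite ler_pdivrMr ?exprn_gt0 //; apply: (le_trans h1).
    by rewrite mulrC ler_wpM2l.
  lra.
have offd (j : 'I_k) : (r < j)%N -> frobsq (c j - pinch f (c j)) <= tau * n%:R.
  move=> rj; rewrite -(ler_pM2r NR).
  apply: (@le_trans _ _ ((\sum_j frobsq (B j - pinch f (B j))) * N%:R)).
    rewrite ler_pM2r // (bigD1 j) //= /B rj lerDl sumr_ge0 // => i _.
    exact: frobsq_ge0.
  apply: (le_trans avg); apply: (@le_trans _ _ (\sum_(j < k) 3 * n%:R)).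
    by apply: ler_sum => i _; exact: bound.
  rewrite sumr_const card_ord -[leLHS]mulr_natr mulrAC [leRHS]mulrAC.
  by rewrite ler_wpM2r.
(* An earlier matrix commutes with [diag_mx l], so its entries between different eigenvalues vanish
   and pinching does not change it. *)
have pinch_id (i : 'I_k) : (i < r)%N -> pinch f (c i) = c i.
  move=> ir; apply/matrixP => a b; rewrite mxE; case: eqP => // fab.
  have := congr1 (fun A : 'M[R]_n => A a b) (cc i r ir).
  rewrite cr mul_mx_diag mul_diag_mx !mxE => /eqP; rewrite mulrC -subr_eq0 -mulrBl.
  rewrite mulf_eq0 subr_eq0 => /orP[/eqP lab|/eqP -> //].
  by case: fab; rewrite /f /shifted_cell /p lab.
(* The lower endpoint of the cell of [a], in the scale of [l]. *)
pose l' : 'rV[R]_n := \row_a (th * ((f a)%:~R * N%:R - (s : nat)%:R)).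
have l'P a : `|l 0 a - l' 0 a| <= th * N%:R.
  rewrite mxE; have -> : l 0 a = th * (l 0 a / th) by rewrite mulrC divfK ?gt_eqF.
  have := floor_itv (l 0 a / th); rewrite -/(p a) rmorphD /= => /andP[p1 p2].
  have NZ : N%:Z != 0 by [].
  have := divz_eq (p a + (s : nat)%:Z) N%:Z; rewrite -/(shifted_cell p s a) -/f => dE.
  have := modz_ge0 (p a + (s : nat)%:Z) NZ.
  have := ltz_pmod (p a + (s : nat)%:Z) (isT : 0 < N%:Z).
  move: dE; set q := (_ %% _)%Z => dE; rewrite -(ler_int R) -lezD1 -(ler_int R).
  rewrite rmorphD /= => q1 q2.
  have paE : (p a)%:~R = (f a)%:~R * N%:R + q%:~R - (s : nat)%:R :> R.
    have := congr1 (fun z : int => z%:~R : R) dE.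
    by rewrite !rmorphD rmorphM /= => <-; rewrite addrK.
  rewrite -mulrBr normrM (ger0_norm (ltW th0)) ler_pM2l //.
  rewrite ler_norml; apply/andP; split; rewrite -?pmulrn in q1 q2 *; lra.
have l'f a b : f a = f b -> l' 0 a = l' 0 b by move=> fab; rewrite !mxE fab.
exists (fun j => if j == r then diag_mx l' else pinch f (c j)); last first.
  move=> i; have [->|ir] := eqVneq i r.
    rewrite cr -linearB /=.
    have -> : frobsq (diag_mx (l - l')) = \sum_a (l 0 a - l' 0 a) ^+ 2.
      apply: eq_bigr => a _; rewrite (bigD1 a) //= !mxE eqxx mulr1n.
      by rewrite big1 ?addr0 // => b ba; rewrite !mxE eq_sym (negPf ba) mulr0n expr0n.
    rewrite mulr_natr -[n in eta *+ n]card_ord -sumr_const; apply: ler_sum => a _.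
    apply: le_trans thN; have := l'P a.
    by rewrite ler_norml => /andP[h1 h2]; nra.
  have [ri|ir'] := ltnP r i.
    apply: (le_trans (offd i ri)); rewrite ler_wpM2r // /tau.
    by rewrite ler_pdivrMr // ler_peMr ?ler1n // ltW.
  rewrite pinch_id ?subrr; last by rewrite ltn_neqAle ir' andbT.
  by rewrite frobsq0 mulr_ge0 // ltW.
have com (i j : 'I_k) : (i <= r)%N -> comm_mx
    (if i == r then diag_mx l' else pinch f (c i))
    (if j == r then diag_mx l' else pinch f (c j)).
  rewrite leq_eqVlt => /orP[/eqP/val_inj ->|ir].
    rewrite eqxx; case: ifP => _; first exact: comm_mx_refl.
    exact: pinch_diag_comm.
  have /negPf -> : i != r by rewrite -val_eqE ltn_eqF.
  case: ifP => _; last by apply: pinch_comm (pinch_id i ir) (cc i j ir).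
  by apply: comm_mx_sym; exact: pinch_diag_comm.
split => [i|i j ir|j rj|i j].
- case: ifP => _; last exact: pinch_sym.
  by rewrite /symmetric_mx tr_diag_mx.
- exact: com.
- have /negPf -> : j != r by rewrite -val_eqE gtn_eqF.
  by apply: pinch_contraction; apply: kc; exact: ltnW.
have com0 (i' j' : 'I_k) : (i' <= r)%N -> frobsq (commutator
    (if i' == r then diag_mx l' else pinch f (c i'))
    (if j' == r then diag_mx l' else pinch f (c j'))) <= eta * n%:R.
  move=> ir; rewrite comm_mx_commutator; last exact: com.
  by rewrite frobsq0 mulr_ge0 // ltW.
have [ri|ir] := ltnP r i; last exact: com0.
have [rj|jr] := ltnP r j; last by rewrite commutatorN frobsqN com0.
have /negPf -> : i != r by rewrite -val_eqE gtn_eqF.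
have /negPf -> : j != r by rewrite -val_eqE gtn_eqF.
apply: (@le_trans _ _ (50 * (tau * n%:R))); last first.
  by rewrite mulrA ler_wpM2r // /tau; lra.
apply: (commutator_perturb (A := c i) (B := c j)).
- exact: pinch_sym.
- exact: sc.
- by apply: pinch_contraction; apply: kc; exact: ltnW.
- by apply: kc; exact: ltnW.
- by apply: (le_trans (ec i j)); rewrite ler_wpM2r.
- exact: offd.
- exact: offd.
Qed.

Lemma commuting_step k (r : 'I_k) (eta : R) : 0 < eta ->
  exists2 eps : R, 0 < eps & forall n (c : 'I_k -> 'M[R]_n),
    almost_commuting r eps c ->
    exists2 c', almost_commuting r.+1 eta c' &
      forall i, frobsq (c i - c' i) <= eta * n%:R.
Proof.
move=> /(commuting_step_diag r)[eps eps0 H]; exists eps => // n c ac.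
have [Q [l [QQ Ql]]] : exists Q : 'M[R]_n, exists l : 'rV[R]_n,
    Q^T *m Q = 1%:M /\ Q^T *m c r *m Q = diag_mx l.
  by apply: spectral_symmetric; case: ac.
have QQ' : Q^T^T *m Q^T = 1%:M by rewrite trmxK orthoC.
have := almost_commuting_conj QQ' ac; rewrite trmxK => ac'.
have [c' ac'' near] := H n _ l ac' Ql.
exists (fun i => Q *m c' i *m Q^T); first exact: almost_commuting_conj.
move=> i; have -> : c i - Q *m c' i *m Q^T = Q *m (Q^T *m c i *m Q - c' i) *m Q^T.
  rewrite mulmxBr mulmxBl !mulmxA orthoC // mul1mx.
  by rewrite -(mulmxA _ Q Q^T) orthoC // mulmx1.
by rewrite frobsq_conj.
Qed.

(** Tolerances are chosen backwards from the last step, so [eps] depends on [k] and [eta] but not on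
    the dimension. *)
Lemma almost_commuting_near k (r : nat) (eta : R) : 0 < eta -> (r <= k)%N ->
  exists2 eps : R, 0 < eps & forall n (c : 'I_k -> 'M[R]_n),
    almost_commuting 0 eps c ->
    exists2 c', almost_commuting r eta c' &
      forall i, frobsq (c i - c' i) <= eta * n%:R.
Proof.
elim: r eta => [|r IHr] eta eta0 rk.
  exists eta => // n c ac; exists c => // i.
  by rewrite subrr frobsq0 mulr_ge0 // ltW.
(* Two errors of [eta / 4] combine to [eta] under the factor 2 bound. *)
have eta4 : 0 < eta / 4 by rewrite divr_gt0.
have [e1 e10 H1] := commuting_step (Ordinal rk) eta4.
have [|e2 e20 H2] := IHr (Num.min e1 (eta / 4)) _ (ltnW rk).
  by rewrite lt_min e10.
exists e2 => // n c /H2[c' [sc' cc' kc' ec'] near'].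
have n0 : 0 <= n%:R :> R by [].
have [|c'' [sc'' cc'' kc'' ec''] near''] := H1 n c'.
  split => // i j; apply: (le_trans (ec' i j)).
  by rewrite ler_wpM2r // ge_min lexx.
exists c''.
  split => // i j; apply: (le_trans (ec'' i j)); rewrite ler_wpM2r //; lra.
move=> i; rewrite -(subrK (c' i) (c i)) -addrA.
apply: (le_trans (frobsqD _ _)); have := near'' i.
have : frobsq (c i - c' i) <= eta / 4 * n%:R.
  apply: (le_trans (near' i)); rewrite ler_wpM2r //.
  by rewrite ge_min lexx orbT.
lra.
Qed.
End AlmostCommuting.

(** * Translation of the norms and the modulus [delta] *)

Section Modulus.
Context {R : realType}.

Lemma frobnormE m n (A : 'M[R]_(m, n)) : frobnorm A = Num.sqrt (frobsq A).
Proof. by []. Qed.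

Lemma specnorm_contraction n (A : 'M[R]_n) : specnorm A <= 1 -> contraction A.
Proof.
move=> A1 x; have [x0|x0] := eqVneq (frobsq x) 0.
  by rewrite (frobsq_eq0 x0) mulmx0 frobsq0.
have xp : 0 < frobsq x by rewrite lt_def x0 frobsq_ge0.
pose t := (Num.sqrt (frobsq x))^-1.
have tx : t ^+ 2 * frobsq x = 1.
  by rewrite exprVn sqr_sqrtr ?frobsq_ge0 // mulVf.
have := A1; rewrite /specnorm; set S := (X in sup X) => S1.
(* The supremum dominates its elements only once the set is bounded; the Frobenius norm is a
   bound. *)
have Sub : has_ubound S.
  exists (Num.sqrt (frobsq A)) => _ [z /= z1 <-].
  rewrite frobnormE ler_sqrt ?frobsq_ge0 //.
  apply: (le_trans (frobsq_mulmx_col A z)); rewrite ler_piMr ?frobsq_ge0 //.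
  by rewrite -(sqr_sqrtr (frobsq_ge0 z)) expr_le1 // sqrtr_ge0.
have tS : S (frobnorm (A *m (t *: x))).
  by exists (t *: x) => //=; rewrite frobnormE frobsqZ tx sqrtr1.
have := le_trans (ub_le_sup Sub tS) S1.
rewrite frobnormE -scalemxAr frobsqZ -[X in _ <= X]sqrtr1 ler_sqrt // -tx.
by rewrite ler_pM2l // exprn_gt0 // invr_gt0 sqrtr_gt0.
Qed.

Lemma trnorm_le d (A : 'M[R]_d) e : (0 < d)%N -> 0 <= e ->
  (trnorm A <= e) = (frobsq A <= e ^+ 2 * d%:R).
Proof.
move=> d0 e0; have dR : 0 < d%:R :> R by rewrite ltr0n.
rewrite /trnorm mulrC ler_pdivrMr ?sqrtr_gt0 // -{1}(ger0_norm e0) -sqrtr_sqr.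
by rewrite -sqrtrM ?sqr_ge0 // ler_sqrt // mulr_ge0 ?sqr_ge0 // ltW.
Qed.

(** The dimension is quantified inside, which makes the modulus independent of [d]. *)
Definition nearly_commuting_bound k (eps eta : R) :=
  forall d (c : 'I_k -> 'M[R]_d), (0 < d)%N ->
    (forall i, symmetric_mx (c i)) -> (forall i, specnorm (c i) <= 1) ->
    (forall i j, trnorm (c i *m c j - c j *m c i) <= eps) ->
    exists cbar : 'I_k -> 'M[R]_d,
      [/\ forall i, symmetric_mx (cbar i), commuting cbar & dist c cbar <= eta].

Lemma nearly_commuting_bound_small k eta : 0 < eta -> exists2 eps0, 0 < eps0 &
  forall eps, 0 < eps -> eps <= eps0 -> nearly_commuting_bound k eps eta.
Proof.
move=> eta0; have eta20 : 0 < eta ^+ 2 by rewrite exprn_gt0.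
have [e e0 H] := almost_commuting_near eta20 (leqnn k).
(* For [eps <= 1] the squared bound [eps ^+ 2] is at most [eps], hence at most [e]. *)
exists (Num.min 1 e) => [|eps eps0]; first by rewrite lt_min ltr01.
rewrite le_min => /andP[eps1 epse] d c d0 sc c1 cc.
have [|c' [sc' cc' _ _] near] := H d c.
  split => // [j _|i j]; first exact: specnorm_contraction.
  have := cc i j; rewrite trnorm_le //; last exact: ltW.
  move/le_trans; apply; rewrite ler_wpM2r ?ler0n //; nra.
exists c'; split => // [i j|]; first exact: cc'.
apply/bigmax_le => [|i _]; first exact: ltW.
by rewrite trnorm_le // ltW.
Qed.

(** The zero tuple is within distance 1 of contractions, so admissible distances exist for every
    [eps]. *)
Lemma nearly_commuting_bound_one k eps : nearly_commuting_bound k eps 1.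
Proof.
move=> d c d0 sc c1 cc; exists (fun=> 0); split => [i|i j|].
- by rewrite /symmetric_mx trmx0.
- exact: comm_mx_refl.
apply/bigmax_le => [|i _]; first exact: ler01.
rewrite subr0 trnorm_le ?ler01 // expr1n mul1r.
exact: contraction_frobsq (specnorm_contraction (c1 i)).
Qed.

(** [delta eps] is the infimum of the admissible distances plus [eps]: the extra term makes it
    positive and leaves room for an infimum that is not attained. *)
Lemma modulus_exists k : exists delta : R -> R,
  [/\ forall eps, 0 < eps -> 0 < delta eps, delta eps @[eps --> 0^'+] --> 0
    & forall eps, 0 < eps -> nearly_commuting_bound k eps (delta eps)].
Proof.
pose S eps := [set eta : R | 0 < eta /\ nearly_commuting_bound k eps eta].
have S0 eps : has_inf (S eps).
  split; first by exists 1; split; [exact: ltr01 | exact: nearly_commuting_bound_one].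
  by exists 0 => eta [/ltW].
have inf0 eps : 0 <= inf (S eps).
  by apply: lb_le_inf; [case: (S0 eps) | move=> eta [/ltW]].
exists (fun eps => inf (S eps) + eps); split.
- by move=> eps eps0; rewrite ltr_wpDl.
- apply/cvgrPdist_lt => /= e e0; have e3 : 0 < e / 3 by rewrite divr_gt0.
  have [eps0 eps00 H] := nearly_commuting_bound_small k e3.
  near=> eps; have eps_gt0 : 0 < eps by [].
  have eps_le : eps <= eps0.
    by near: eps; apply: nbhs_right_le.
  have eps3 : eps < e / 3 by near: eps; exact: nbhs_right_lt.
  have : inf (S eps) <= e / 3.
    by apply: ge_inf; [case: (S0 eps) | split => //; exact: H].
  have := inf0 eps; rewrite sub0r normrN ger0_norm; first lra.
  by rewrite addr_ge0 // ltW.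
move=> eps eps0 d c d0 sc c1 cc.
have [eta [_ Heta] lt] := inf_adherent eps0 (S0 eps).
have [cbar [sb cb db]] := Heta d c d0 sc c1 cc.
by exists cbar; split => //; apply: (le_trans db); exact: ltW.
Unshelve. all: by end_near.
Qed.
End Modulus.

Theorem corollary4p7 (R : realType) (k : nat) :
  exists delta : R -> R,
    [/\ forall eps, 0 < eps -> 0 < delta eps,
        delta eps @[eps --> 0^'+] --> 0
      & forall (d : nat) (eps : R) (c : 'I_k -> 'M[R]_d),
          (k < d)%N -> 0 < eps ->
          (forall i, symmetric_mx (c i)) ->
          (forall i, specnorm (c i) <= 1) ->
          (forall i j, trnorm (c i *m c j - c j *m c i) <= eps) ->
          (exists cbar : 'I_k -> 'M[R]_d,
             [/\ forall i, symmetric_mx (cbar i), commuting cbar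
               & dist c cbar <= delta eps]) /\
          (forall cbar : 'I_k -> 'M[R]_d,
             (forall i, symmetric_mx (cbar i)) -> commuting cbar ->
             dist c cbar <= delta eps ->
             forall (mu : R) (Q : 'M[R]_d) (m : 'I_k -> 'cV[R]_d),
               0 < mu -> coeffs mu cbar ->
               diagonalizes Q cbar m -> lp_unique_optimum m ->
               exists Cbar : set ('I_k -> 'M[R]_d),
                 [/\ full_dim_nbhd mu cbar Cbar,
                     forall c', Cbar c' -> sdp_rank_one c'
                   & (dist c cbar <= delta eps -> Cbar c) ->
                     sdp_rank_one c])].
Proof.
have [delta [delta0 delta_lim bound]] := @modulus_exists R k.
exists delta; split => // d eps c kd eps0 sc c1 cc.
have d0 : (0 < d)%N := leq_ltn_trans (leq0n k) kd.
split; first exact: bound.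
move=> cbar _ _ near mu Q m mu0 cC diag lp.
(* The neighborhood is the part of the coefficient set in an entrywise ball on which the certificate
   works. *)
have [r r0 rP] := sdp_local kd diag lp.
exists (coeffs mu `&` entry_ball cbar r).
have rank c' : (coeffs mu `&` entry_ball cbar r) c' -> sdp_rank_one c'.
  move=> [/coeffs_quad c'C /(entry_ballP _ _ r0) c'r].
  by apply: rP => // i; case: (c'C i).
split => //; first exact: full_dim_entry_ball.
by move=> /(_ near); exact: rank.
Qed.
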